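(* Let $\{u_h^n\}_{n\in\mathbb N}\subset V_h$ be the sequence produced by the semi-implicit Euler / finite element discretization $$u_h^{n+1}-u_h^n=\Delta u_h^{n+1}\,\tau-(u_h^n)^3\,\tau+\sqrt2\,\delta W^n,\qquad u_h^n\in V_h,$$ of the SPDE $du=(-u^3+\Delta u)\,dt+\sqrt2\,dW_t$ on $[0,1]$ with Dirichlet boundary conditions. There exists a constant $a_0>0$, dependent on $h$ and $\tau$, such that if $\mathbb E\|u_h^0\|^2>a_0$ then $$\mathbb E\|u_h^n\|^2\ge\mathbb E\|u_h^0\|^2+n\tau\longrightarrow\infty\qquad\text{as }n\to\infty.$$
   Context: $\|\cdot\|$ and $(\cdot,\cdot)$ are the norm and scalar product of $L^2=L^2((0,1);\mathbb R)$. $V_h$ is the space of continuous piecewise linear functions on $[0,1]$, vanishing at $0$ and $1$, over the uniform mesh $x_j=jh$, $h=1/N$. $\tau>0$ is the time step, $t_n=n\tau$, $\delta W^n=W(t_{n+1})-W(t_n)$, where $W(t)=\sum_j\sqrt{\gamma_j}\,\tilde e_j\beta_j(t)$ is a $Q$-Wiener process: $Q$ is symmetric, positive, trace class on $L^2$, with $Q\tilde e_j=\gamma_j\tilde e_j$, $\{\tilde e_j\}$ an orthonormal basis, $\gamma_j\ge 0$, $\sum_j\gamma_j<\infty$, and $\beta_j$ independent standard one-dimensional Brownian motions. The initial datum $u_h^0\in V_h$ may be random, independent of $W$. The scheme is understood in $V_h$ in the weak sense: for every $\psi\in V_h$, $(u_h^{n+1}-u_h^n,\psi)=-\tau(\nabla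 u_h^{n+1},\nabla\psi)-\tau((u_h^n)^3,\psi)+\sqrt2(\delta W^n,\psi)$. *)

(* Defs.v *)
From HB Require Import structures.
From mathcomp Require Import all_boot all_order all_algebra.
From mathcomp Require Import all_classical all_reals all_analysis.

Set Implicit Arguments.
Unset Strict Implicit.
Unset Printing Implicit Defensive.

Import Order.TTheory GRing.Theory Num.Theory.
Import numFieldNormedType.Exports.

Local Open Scope classical_set_scope.
Local Open Scope ring_scope.

Section L2_space.
Variable R : realType.

Definition leb01 : {measure set (measurableTypeR R) -> \bar R} :=
  mrestr (@lebesgue_measure R) (measurable_itv `]0%R, 1%R[).

(* Square-integrable functions, not classes: equalities between elements of
   L^2((0,1)) are stated [leb01]-almost everywhere. *)
Definition L2 := LfunType leb01 (lee1n 2).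

Definition ip (f g : R -> R) : R := (\int[leb01]_x (f x * g x))%R.

Definition L2norm (f : R -> R) : R := Num.sqrt (ip f f).

Definition orthonormal_basis (e : nat -> L2) : Prop :=
  (forall i j, ip (e i) (e j) = (i == j)%:R) /\
  (forall f : L2,
     L2norm (f - \sum_(j < n) ip f (e j) *: e j) @[n --> \oo] --> (0 : R)).

Definition L2_linear (Q : L2 -> L2) : Prop :=
  forall (a : R) (f g : L2), Q (a *: f + g) = a *: Q f + Q g %[ae leb01].

Definition L2_bounded (Q : L2 -> L2) : Prop :=
  exists C : R, forall f : L2, L2norm (Q f) <= C * L2norm f.

Definition L2_symmetric (Q : L2 -> L2) : Prop :=
  forall f g : L2, ip (Q f) g = ip f (Q g).

Definition L2_positive (Q : L2 -> L2) : Prop :=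
  forall f : L2, 0 <= ip (Q f) f.

(* For positive operators, finiteness of the trace in one orthonormal basis
   amounts to finiteness, with the same value, in all of them. *)
Definition trace_class (Q : L2 -> L2) : Prop :=
  exists b : nat -> L2, orthonormal_basis b /\
    (\sum_(0 <= j <oo) (ip (Q (b j)) (b j))%:E < +oo)%E.

Record covariance_operator (Q : L2 -> L2) (e : nat -> L2) (gamma : nat -> R) :
    Prop := {
  cov_linear : L2_linear Q ;
  cov_bounded : L2_bounded Q ;
  cov_symmetric : L2_symmetric Q ;
  cov_positive : L2_positive Q ;
  cov_trace_class : trace_class Q ;
  cov_basis : orthonormal_basis e ;
  cov_eigen : forall j, Q (e j) = gamma j *: e j %[ae leb01] ;
  cov_eigen_ge0 : forall j, 0 <= gamma j ;
  cov_eigen_summable : (\sum_(0 <= j <oo) (gamma j)%:E < +oo)%E }.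

End L2_space.

Section probability.
Variables (R : realType) (d : measure_display) (Omega : measurableType d).
Variable P : probability Omega R.

Definition sigma_generated (I : Type) (D : set I) (X : I -> Omega -> R) :
    set (set Omega) :=
  <<s \bigcup_(i in D) preimage_set_system setT (X i) measurable >>.

Definition independent (F G : set (set Omega)) : Prop :=
  forall A B, F A -> G B -> P (A `&` B) = (P A * P B)%E.

Definition mutually_independent (I : eqType) (F : I -> set (set Omega)) : Prop :=
  forall (s : seq I) (A : I -> set Omega), uniq s ->
    (forall i, i \in s -> F i (A i)) ->
    P (\bigcap_(i in [set` s]) A i) = (\prod_(i <- s) P (A i))%E.

(* The time set is [0, +oo[: values of processes at negative times are
   irrelevant. *)
Record brownian_motion (B : R -> Omega -> R) : Prop := {
  bm_measurable : forall t : R, 0 <= t -> measurable_fun setT (B t) ;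
  bm_start : {ae P, forall w, B 0 w = 0} ;
  bm_independent_increments : forall t : nat -> R,
    0 <= t 0%N -> (forall k, t k <= t k.+1) ->
    mutually_independent (fun k =>
      sigma_generated [set: unit] (fun _ => B (t k.+1) - B (t k))) ;
  bm_gaussian_increments : forall s t : R, 0 <= s -> s < t ->
    forall A : set R, measurable A ->
      pushforward P (B t - B s) A = normal_prob 0 (Num.sqrt (t - s)) A ;
  bm_continuous :
    {ae P, forall w, {within `[0, +oo[, continuous (fun t => B t w)}} }.

(* [L2 R] being separable, weak measurability is Borel measurability, and the
   products against all f generate the sigma-algebra of the random element. *)
Definition L2_measurable (X : Omega -> R -> R) : Prop :=
  forall f : L2 R, measurable_fun setT (fun w => ip (X w) f).

Definition L2_sigma (I : Type) (D : set I) (X : I -> Omega -> R -> R) :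
    set (set Omega) :=
  sigma_generated [set p : I * L2 R | D p.1] (fun p w => ip (X p.1 w) p.2).

Definition mean_sqnorm (X : Omega -> R -> R) : \bar R :=
  ('E_P[fun w => (L2norm (X w) ^+ 2)%R])%E.

(* The series defining W(t) converges in L^2(Omega; L^2(0,1)). *)
Record Q_wiener (e : nat -> L2 R) (gamma : nat -> R)
    (beta : nat -> R -> Omega -> R) (W : R -> Omega -> L2 R) : Prop := {
  wiener_brownian : forall j, brownian_motion (beta j) ;
  wiener_independent : mutually_independent (fun j =>
    sigma_generated [set t : R | 0 <= t] (beta j)) ;
  wiener_measurable : forall t : R, 0 <= t -> L2_measurable (W t) ;
  wiener_series : forall t : R, 0 <= t ->
    mean_sqnorm (fun w =>
        W t w - \sum_(j < n) (Num.sqrt (gamma j) * beta j t w) *: e j)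
      @[n --> \oo] --> 0%E }.

End probability.

(* Functions on [0,1] vanishing at the end points are represented by their
   extension by zero to the real line. *)
Definition Vh (R : realType) (N : nat) : set (R -> R) :=
  [set v : R -> R | [/\ continuous v,
    forall x : R, x \notin `]0, 1[ -> v x = 0 &
    forall j, (j < N)%N -> exists a b : R,
      forall x : R, x \in `[j%:R / N%:R, j.+1%:R / N%:R] -> v x = a * x + b]].

Definition fem_euler_scheme (R : realType) (d : measure_display)
    (Omega : measurableType d) (P : probability Omega R) (N : nat) (tau : R)
    (W : R -> Omega -> L2 R) (u : nat -> Omega -> R -> R) : Prop :=
  forall n : nat, {ae P, forall w, forall psi : R -> R, Vh N psi ->
    ip (u n.+1 w - u n w) psi =
      - tau * ip (derive1 (u n.+1 w)) (derive1 psi)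
      - tau * ip (fun x => u n w x ^+ 3) psi
      + Num.sqrt 2 * ip (W (n.+1%:R * tau) w - W (n%:R * tau) w) psi}.

(* Main.v *)
Require Import Defs.
From HB Require Import structures.
From mathcomp Require Import all_boot all_order all_algebra.
From mathcomp Require Import all_classical all_reals all_analysis.
From mathcomp Require Import measurable_realfun ring lra.

Set Implicit Arguments.
Unset Strict Implicit.
Unset Printing Implicit Defensive.

Import Order.TTheory GRing.Theory Num.Theory.
Import numFieldNormedType.Exports.

Local Open Scope classical_set_scope.
Local Open Scope ring_scope.

(** The explicit cubic drift overshoots: as soon as [u^n] is large, the new
    iterate is larger still.  This is made quantitative by testing the scheme
    with [psi = u^n].

    Put [x = |u^n|^2], [y = |u^{n+1}|^2], [z = sqrt 2 (dW^n, u^n)] and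
    [a(u, v) = (u, v) + tau (u', v')].  The scheme tested with [u^n] reads
    [a(u^{n+1}, u^n) = x - tau ((u^n)^3, u^n) + z].  Two facts about [V_h]
    enter: [x^2 <= ((u^n)^3, u^n)] by Cauchy-Schwarz on an interval of length
    one ([Vh_pow4]), and [|a(u, v)| <= K |u| |v|] with [K] depending on [h] and
    [tau], because [V_h] has finite dimension ([form_bounded]).  Hence
    [tau x^2 - x - z <= - a(u^{n+1}, u^n) <= K sqrt (x y)], and
    [2 K sqrt (x y) <= K^2 y + x] gives
    [2 tau x^2 - 3 x - 2 z <= K^2 y] ([scheme_energy]).  The parabola on the
    left lies above each of its tangents, in particular above one of slope
    [2 K^2] ([growth_poly]), so that almost surely
    [2 x - c - (2 / K^2) z <= y] with [c] depending on [K] and [tau] only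
    ([growth]).

    The noise occurs linearly, in [z].  If [E x] is finite, then [E z = 0] and
    [E y >= 2 E x - c], which is at least [E x + tau] when [E x >= c + tau]
    ([mean_step]).  If [E x] is infinite, then [E y] is infinite too, since [z]
    can be absorbed into [x] and the square of the noise, which is integrable
    ([mean_finite_back]).  The threshold is [a0 = c + tau], and the bound
    propagates by induction.

    The probabilistic part is [E z = 0].  Solving the scheme step by step, the
    nodal values of [u^n] are almost surely functions of [u^0] and of the
    increments of [W] before time [t_n] ([nodal_known]), so it is enough that
    the noise of step [n] integrates to zero over every event that is known
    at time [t_n] ([history_centred]).  By Dynkin's lemma it suffices to take
    the intersection of an event of [u^0], which splits off by independence, and
    an event of [W] that coincides almost surely with an event of the Brownian
    increments before [t_n].  On events of the latter kind the increments of
    each [beta_j] over [[t_n, t_{n+1}]] integrate to zero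
    ([past_centred]), and so does their mean-square limit, the noise of
    step [n]. *)

(** * Integrals of weighted images *)
Import HBNNSimple.

Section generic_measure.
Local Open Scope ereal_scope.
Context d (T : measurableType d) (R : realType) (mu : {measure set T -> \bar R}).

(** Both sides are suprema over the simple functions below the integrand.  This
    covers integrands which are not known to be measurable, such as the norm
    of a weakly measurable random element of [L^2]. *)
Lemma le_integral_ge0 (f g : T -> \bar R) :
  (forall x, 0 <= f x) -> (forall x, f x <= g x) ->
  \int[mu]_x f x <= \int[mu]_x g x.
Proof.
move=> f0 fg; have g0 x : 0 <= g x by exact: le_trans (fg x).
rewrite !ge0_integralTE//; apply: ereal_sup_le => _ [h hf <-] /=.
by exists h => // x; exact: le_trans (hf x) (fg x).
Qed.

Lemma measurable_preim d2 (T2 : measurableType d2) (X : T -> T2) (B : set T2) :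
  measurable_fun setT X -> measurable B -> measurable (X @^-1` B).
Proof. by move=> mX mB; rewrite -[X in measurable X]setTI; exact: mX. Qed.

Lemma integral_weight_nnsfun d2 (T2 : measurableType d2) (phi : T -> T2)
    (g : T -> R) (h : {nnsfun T2 >-> R}) :
  measurable_fun setT phi -> measurable_fun setT g -> (forall x, 0 <= g x)%R ->
  \int[mu]_x (h (phi x) * g x)%:E =
  \sum_(y \in range h) (y%:E *
    \int[mu]_(x in phi @^-1` (h @^-1` [set y])) (g x)%:E).
Proof.
move=> mphi mg g0.
have mhy y : measurable (phi @^-1` (h @^-1` [set y])) by exact: measurable_preim.
transitivity (\int[mu]_x \sum_(y \in range h)
    (y * (\1_(phi @^-1` (h @^-1` [set y])) x * g x))%:E).
  apply: eq_integral => x _; rewrite fimfunE fsumEFin//.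
  congr EFin; rewrite mulrC mulr_fsumr//.
  by apply: eq_fsbigr => y _; rewrite mulrC mulrA.
rewrite ge0_integral_fsum//; last 2 first.
- by move=> y; apply/measurable_EFinP/measurable_funM/measurable_funM.
- move=> y x _; rewrite /= mulrA EFinM mule_ge0 ?lee_fin//= -lee_fin EFinM.
  exact: (nnfun_muleindic_ge0 h y (phi x)).
apply: eq_fsbigr => y; rewrite inE => -[z _ <-].
under eq_integral do rewrite EFinM.
rewrite ge0_integralZl//; last 3 first.
- by apply/measurable_EFinP/measurable_funM.
- by move=> x _; rewrite lee_fin mulr_ge0.
- by rewrite lee_fin.
congr (_ * _); rewrite [RHS]integral_mkcond; apply: eq_integral => x _.
rewrite /patch indicE; case: ifPn => xA; first by rewrite mul1r.
by rewrite mul0r.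
Qed.

Lemma integral_weight_lim d2 (T2 : measurableType d2) (phi : T -> T2)
    (g : T -> R) (f : T2 -> \bar R) (mf : measurable_fun setT f) :
  measurable_fun setT phi -> measurable_fun setT g -> (forall x, 0 <= g x)%R ->
  (forall y, 0 <= f y) ->
  \int[mu]_x (f (phi x) * (g x)%:E) =
  limn (fun n => \int[mu]_x (nnsfun_approx measurableT mf n (phi x) * g x)%:E).
Proof.
move=> mphi mg g0 f0; rewrite -monotone_convergence//.
- apply: eq_integral => x _; apply/esym/cvg_lim => //.
  under eq_fun do rewrite EFinM.
  by apply: cvgeZr => //; exact: cvg_nnsfun_approx.
- move=> n; apply/measurable_EFinP/measurable_funM => //.
  exact: measurableT_comp.
- by move=> n x _; rewrite lee_fin mulr_ge0.
- move=> x _ a b ab; rewrite lee_fin ler_wpM2r//.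
  exact/lefP/nd_nnsfun_approx.
Qed.

End generic_measure.

Section change_of_weight.
Local Open Scope ereal_scope.
Context d1 (T1 : measurableType d1) d2 (T2 : measurableType d2)
  d3 (T3 : measurableType d3) (R : realType).
Variables (mu1 : {measure set T1 -> \bar R}) (mu2 : {measure set T2 -> \bar R}).
Variables (phi1 : T1 -> T3) (phi2 : T2 -> T3) (g1 : T1 -> R) (g2 : T2 -> R).
Hypotheses (mphi1 : measurable_fun setT phi1) (mphi2 : measurable_fun setT phi2).
Hypotheses (mg1 : measurable_fun setT g1) (mg2 : measurable_fun setT g2).
Hypotheses (g10 : forall x, (0 <= g1 x)%R) (g20 : forall x, (0 <= g2 x)%R).
Hypothesis eqA : forall A, measurable A ->
  \int[mu1]_(x in phi1 @^-1` A) (g1 x)%:E =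
  \int[mu2]_(x in phi2 @^-1` A) (g2 x)%:E.

(** Two weighted image measures which agree on sets agree on functions.  Gaussian
    moments (a law against a density), the symmetry of Lebesgue measure,
    independence (weight [\1_A] against the constant weight [P A]) and the
    orthogonality of a centred variable to known ones (weights [b^\+] and
    [b^\-]) are all instances of this statement. *)
Lemma ge0_integral_change_of_weight (f : T3 -> \bar R) :
  measurable_fun setT f -> (forall y, 0 <= f y) ->
  \int[mu1]_x (f (phi1 x) * (g1 x)%:E) = \int[mu2]_x (f (phi2 x) * (g2 x)%:E).
Proof.
move=> mf f0; rewrite !(integral_weight_lim _ mf)//; congr (limn _).
apply/funext => n; rewrite !integral_weight_nnsfun//.
by apply: eq_fsbigr => y _; rewrite eqA.
Qed.

Lemma integral_change_of_weight (f : T3 -> R) :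
  measurable_fun setT f ->
  \int[mu1]_x (f (phi1 x) * g1 x)%:E = \int[mu2]_x (f (phi2 x) * g2 x)%:E.
Proof.
move=> mf.
have E d (T : measurableType d) (mu : {measure set T -> \bar R})
    (phi : T -> T3) (g : T -> R) : (forall x, (0 <= g x)%R) ->
    \int[mu]_x (f (phi x) * g x)%:E =
    \int[mu]_x ((EFin \o f)^\+ (phi x) * (g x)%:E) -
    \int[mu]_x ((EFin \o f)^\- (phi x) * (g x)%:E).
  move=> g0; rewrite integralE; congr (_ - _); apply: eq_integral => x _.
    by rewrite !funeposE/= -!EFin_max -EFinM maxr_pMl// mul0r.
  by rewrite !funenegE/= -?EFinN -!EFin_max -EFinM maxr_pMl// mul0r mulNr.
rewrite !E//; congr (_ - _); apply: ge0_integral_change_of_weight => //.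
- exact/measurable_funepos/measurable_EFinP.
- exact/measurable_funeneg/measurable_EFinP.
Qed.

End change_of_weight.

(** * Square-integrable functions *)
Section L2_algebra.
Context d (T : measurableType d) (R : realType) (mu : {measure set T -> \bar R}).

Definition dot (f g : T -> R) : R := (\int[mu]_x (f x * g x))%R.

Definition sqint (f : T -> R) : Prop := f \in Lfun mu 2%:E.

Lemma sqint_measurable f : sqint f -> measurable_fun setT f.
Proof. by rewrite /sqint inE => /andP[/set_mem]. Qed.

Lemma sqint_mul_integrable f g : sqint f -> sqint g ->
  mu.-integrable setT (fun x => (f x * g x)%:E).
Proof. by move=> Hf Hg; exact/Lfun1_integrable/Lfun2_mul_Lfun1. Qed.

Lemma sqintP f : sqint f <->
  measurable_fun setT f /\ (\int[mu]_x (f x ^+ 2)%:E < +oo)%E.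
Proof.
split=> [Hf|[mf fy]].
  split; first exact: sqint_measurable.
  have /integrableP[_] := Lfun2_integrable_sqr Hf.
  apply: le_lt_trans; apply: le_integral_ge0 => x.
    by rewrite lee_fin sqr_ge0.
  by rewrite /= ger0_norm ?sqr_ge0.
rewrite /sqint inE; apply/andP; split; rewrite inE//=.
rewrite /finite_norm unlock /Lnorm poweR_lty//.
apply: le_lt_trans fy; apply: le_integral_ge0 => x.
  by rewrite poweR_ge0.
rewrite /= lee_fin powR_mulrn// -normrX ger0_norm ?sqr_ge0//.
Qed.

Lemma sqint_scale a f : sqint f -> sqint (fun x => a * f x).
Proof.
move=> Hf; have := @Lfun_scale _ _ _ mu f a 2 (ler1n _ _) Hf.
rewrite /sqint (_ : _ \o* _ = fun x => a * f x)//.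
by apply/funext => x /=; rewrite mulrC.
Qed.

Lemma sqintD f g : sqint f -> sqint g -> sqint (fun x => f x + g x).
Proof. exact: (Lfun_addr_closed mu (lee1n 2)).2. Qed.

Lemma sqintB f g : sqint f -> sqint g -> sqint (fun x => f x - g x).
Proof.
move=> Hf Hg; under eq_fun do rewrite -mulN1r.
by apply: sqintD => //; exact: sqint_scale.
Qed.

Lemma sqint0 : sqint (fun=> 0).
Proof. exact: (Lfun_addr_closed mu (lee1n 2)).1. Qed.

Lemma sqint_sum I (s : seq I) (F : I -> T -> R) :
  (forall i, sqint (F i)) -> sqint (fun x => \sum_(i <- s) F i x).
Proof.
move=> HF; elim: s => [|i s IH].
  by under eq_fun do rewrite big_nil; exact: sqint0.
by under eq_fun do rewrite big_cons; exact: sqintD.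
Qed.

Lemma dotE f g : sqint f -> sqint g ->
  (\int[mu]_x (f x * g x)%:E)%E = (dot f g)%:E.
Proof.
move=> Hf Hg; rewrite /dot /Rintegral fineK//.
by apply: integrable_fin_num => //; exact: sqint_mul_integrable.
Qed.

Lemma dotC f g : dot f g = dot g f.
Proof. by apply: eq_Rintegral => x _; rewrite mulrC. Qed.

Lemma dot_ge0 f : 0 <= dot f f.
Proof. by apply: Rintegral_ge0 => x _; rewrite -expr2 sqr_ge0. Qed.

Lemma dotDl f g h : sqint f -> sqint g -> sqint h ->
  dot (fun x => f x + g x) h = dot f h + dot g h.
Proof.
move=> Hf Hg Hh; rewrite /dot -RintegralD//; try exact: sqint_mul_integrable.
by apply: eq_Rintegral => x _; rewrite mulrDl.
Qed.

Lemma dotZl a f h : sqint f -> sqint h -> dot (fun x => a * f x) h = a * dot f h.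
Proof.
move=> Hf Hh; rewrite /dot -RintegralZl//; try exact: sqint_mul_integrable.
by apply: eq_Rintegral => x _; rewrite mulrA.
Qed.

Lemma dotBl f g h : sqint f -> sqint g -> sqint h ->
  dot (fun x => f x - g x) h = dot f h - dot g h.
Proof.
move=> Hf Hg Hh; rewrite /dot -RintegralB//; try exact: sqint_mul_integrable.
by apply: eq_Rintegral => x _; rewrite mulrBl.
Qed.

Lemma dot_suml I (s : seq I) (F : I -> T -> R) h :
  (forall i, sqint (F i)) -> sqint h ->
  dot (fun x => \sum_(i <- s) F i x) h = \sum_(i <- s) dot (F i) h.
Proof.
move=> HF Hh; elim: s => [|i s IH].
  rewrite big_nil /dot; under eq_Rintegral do rewrite big_nil mul0r.
  by rewrite /Rintegral integral0.
rewrite big_cons -IH -dotDl//; last exact: sqint_sum.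
by apply: eq_Rintegral => x _; rewrite big_cons.
Qed.

(** The quadratic polynomial [t |-> |f - t g|^2] has no negative value. *)
Lemma dot_CS f g : sqint f -> sqint g -> dot f g ^+ 2 <= dot f f * dot g g.
Proof.
move=> Hf Hg.
have H t : 0 <= dot f f - t * dot f g *+ 2 + t ^+ 2 * dot g g.
  have Hfg : sqint (fun x => f x - t * g x).
    by apply: sqintB => //; exact: sqint_scale.
  have := dot_ge0 (fun x => f x - t * g x).
  rewrite dotBl//; last exact: sqint_scale.
  rewrite dotZl// (dotC f) (dotC g) !dotBl//; try exact: sqint_scale.
  rewrite !dotZl// (dotC g f); congr (_ <= _); ring.
have := dot_ge0 g; rewrite le_eqVlt => /orP[/eqP g0|g0].
  have [->|fg] := eqVneq (dot f g) 0.
    by rewrite expr0n/= mulr_ge0// dot_ge0.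
  have := H ((dot f f + 1) / dot f g); rewrite -g0 divfK// mulr0.
  have := dot_ge0 f; lra.
have := H (dot f g / dot g g).
rewrite -(pmulr_lge0 _ g0); set a := dot f f; set b := dot f g; set c := dot g g in g0 *.
have -> : a - b / c * b *+ 2 + (b / c) ^+ 2 * c = (a * c - b ^+ 2) / c.
  by field; rewrite gt_eqF.
by rewrite -mulrA mulVf ?gt_eqF// mulr1 subr_ge0.
Qed.

End L2_algebra.

(** * Moments of the centred normal law *)
Section normal_moments.
Context (R : realType).
Notation mu := (@lebesgue_measure R).

Lemma normal_pdfN s (x : R) : s != 0 ->
  normal_pdf 0 s (- x) = normal_pdf 0 s x.
Proof. by move=> s0; rewrite !normal_pdfE// /normal_fun !subr0 sqrrN. Qed.

(** With [t = x^2 / (4 s^2)], the inequality [t <= exp t] trades half of the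
    Gaussian exponent for the factor [x^2]; what remains is a multiple of the
    density of variance [2 s^2]. *)
Lemma normal_second_moment s : s != 0 ->
  (\int[mu]_x (x ^+ 2 * normal_pdf 0 s x)%:E < +oo)%E.
Proof.
move=> s0; pose s' := Num.sqrt 2 * s.
have s'0 : s' != 0 by rewrite mulf_neq0// gt_eqF// sqrtr_gt0.
have s'2 : s' ^+ 2 = 2 * s ^+ 2 by rewrite exprMn sqr_sqrtr.
pose C := 4 * s ^+ 2 * normal_peak s / normal_peak s'.
have s20 : 0 < s ^+ 2 by rewrite exprn_even_gt0.
have C0 : 0 <= C.
  rewrite /C divr_ge0 ?normal_peak_ge0//.
  by rewrite mulr_ge0 ?normal_peak_ge0// mulr_ge0// ltW.
apply: (@le_lt_trans _ _ (\int[mu]_x (C * normal_pdf 0 s' x)%:E)%E).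
  apply: le_integral_ge0 => x.
    by rewrite lee_fin mulr_ge0 ?sqr_ge0 ?normal_pdf_ge0.
  rewrite lee_fin !normal_pdfE// /normal_fun !subr0.
  rewrite s'2 /C.
  set p := normal_peak s; set q := normal_peak s'.
  have q0 : q != 0 by rewrite gt_eqF// normal_peak_gt0.
  rewrite [leRHS](_ : _ = 4 * s ^+ 2 * p *
    expR (- x ^+ 2 / ((2 * s ^+ 2) *+ 2))); last first.
    by rewrite [in RHS]mulrC; field.
  set t := x ^+ 2 / (s ^+ 2 *+ 2 *+ 2).
  have -> : - x ^+ 2 / (s ^+ 2 *+ 2) = - t + - t by rewrite /t; field.
  have -> : - x ^+ 2 / ((2 * s ^+ 2) *+ 2) = - t by rewrite /t; field.
  have -> : x ^+ 2 = 4 * s ^+ 2 * t by rewrite /t; field.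
  rewrite expRD; set E := expR (- t).
  rewrite [leLHS](_ : _ = (4 * s ^+ 2 * p * E) * (t * E)); last by ring.
  have cE : 0 <= 4 * s ^+ 2 * p * E.
    rewrite mulr_ge0 ?expR_ge0// mulr_ge0 ?normal_peak_ge0// mulr_ge0//.
    exact: ltW.
  rewrite ler_piMr// /E expRN ler_pdivrMr ?expR_gt0// mul1r.
  by apply: (le_trans _ (expR_ge1Dx _)); rewrite lerDr.
under eq_integral do rewrite EFinM.
rewrite ge0_integralZl//=; last 2 first.
- by apply/measurable_EFinP; exact: measurable_normal_pdf.
- by move=> x _; rewrite lee_fin normal_pdf_ge0.
- by rewrite integral_normal_pdf mule1 ltry.
Qed.

Lemma normal_integrable_id s : s != 0 ->
  mu.-integrable setT (fun x => (x * normal_pdf 0 s x)%:E).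
Proof.
move=> s0.
have mpdf : measurable_fun setT (normal_pdf 0 s) by exact: measurable_normal_pdf.
apply: (@le_integrable _ _ _ mu _ measurableT _
  (fun x => (x ^+ 2 * normal_pdf 0 s x)%:E + (normal_pdf 0 s x)%:E)%E).
- by apply/measurable_EFinP/measurable_funM.
- move=> x _; have p0 := normal_pdf_ge0 0 s x.
  rewrite /= lee_fin normrM (ger0_norm p0) [leRHS]ger0_norm; last first.
    by rewrite addr_ge0// mulr_ge0// sqr_ge0.
  rewrite -{3}[normal_pdf 0 s x]mul1r -mulrDl ler_wpM2r//.
  rewrite -(real_normK (num_real x)).
  by have := sqr_ge0 (`|x| - 1); have := normr_ge0 x; nra.
- apply: integrableD => //; last exact: integrable_normal_pdf.
  apply/integrableP; split.
    by apply/measurable_EFinP/measurable_funM.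
  apply: le_lt_trans (normal_second_moment s0); rewrite le_eqVlt; apply/orP.
  left; apply/eqP/eq_integral.
  by move=> x _; rewrite /= ger0_norm// mulr_ge0 ?sqr_ge0 ?normal_pdf_ge0.
Qed.

(** The reflection [x |-> - x] preserves Lebesgue measure and the density, so the
    integral is its own opposite. *)
Lemma normal_mean0 s : s != 0 -> (\int[mu]_x (x * normal_pdf 0 s x)%:E = 0)%E.
Proof.
move=> s0; set I := (\int[mu]_x _)%E.
have mf : measurable_fun setT (fun x : R => x * normal_pdf 0 s x).
  by apply: measurable_funM => //; exact: measurable_normal_pdf.
have Ifin : (I \is a fin_num)%E.
  by apply: integrable_fin_num => //; exact: normal_integrable_id.
have IN : (I = - I)%E.
  have E1 D : measurable D -> (\int[mu]_(x in D) (cst (1 : R) x)%:E = mu D)%E.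
    by move=> mD; rewrite (integral_cst mu mD 1%:E) mul1e.
  have mN : measurable_fun setT (-%R : R -> R) by [].
  have mid : measurable_fun setT (idfun : R -> R) by exact: measurable_id.
  have E A : measurable A ->
      (\int[mu]_(x in (-%R : R -> R) @^-1` A) (cst (1 : R) x)%:E =
       \int[mu]_(x in idfun @^-1` A) (cst (1 : R) x)%:E)%E.
    move=> mA; apply: (etrans (E1 _ _)).
      by rewrite -[X in measurable X]setTI; exact: mN.
    by rewrite (E1 A mA); exact: lebesgue_measureN.
  have H := @integral_change_of_weight _ (measurableTypeR R)
    _ (measurableTypeR R) _ (measurableTypeR R) R mu mu _ _ _ _
    mN mid (measurable_cst (1 : R))
    (measurable_cst (1 : R)) (fun=> ler01) (fun=> ler01) E _ mf.
  rewrite {1}/I; under eq_integral do rewrite -[_ * _]mulr1.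
  rewrite -[LHS]H /I -(@integralN _ _ _ mu setT); last first.
    exact: integrable_add_def (normal_integrable_id s0).
  by apply: eq_integral => x _; rewrite mulr1 normal_pdfN// mulNr EFinN.
move: Ifin IN; rewrite -/I; case: I => // r _ [] rN.
by congr EFin; lra.
Qed.
End normal_moments.

(** * Events over which a variable integrates to zero *)
Section centred.
Context (R : realType) d (Omega : measurableType d) (P : probability Omega R).

Definition centred_on (G : set (set Omega)) (b : Omega -> R) : Prop :=
  forall A, G A -> (\int[P]_(w in A) (b w)%:E = 0)%E.

Lemma integral_set_indic (A : set Omega) (b : Omega -> R) :
  (\int[P]_(w in A) (b w)%:E = \int[P]_w (b w * \1_A w)%:E)%E.
Proof.
rewrite integral_mkcond; apply: eq_integral => w _.
by rewrite patchE indicE; case: ifPn => wA; rewrite ?mulr1 ?mulr0.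
Qed.

(** The weights [\1_A] and [P A] give the same image measure under [X], by
    independence of [A] and [X]. *)
Lemma centred_indep (A : set Omega) (X : Omega -> R) :
  measurable A -> P.-integrable setT (EFin \o X) ->
  (\int[P]_w (X w)%:E = 0)%E ->
  (forall B : set R, measurable B ->
    P (A `&` X @^-1` B) = (P A * P (X @^-1` B))%E) ->
  (\int[P]_(w in A) (X w)%:E = 0)%E.
Proof.
move=> mA iX X0 AX.
have mX : measurable_fun setT X by exact/measurable_EFinP/(measurable_int P).
rewrite integral_set_indic.
have PA : P A = (fine (P A))%:E by rewrite fineK ?fin_num_measure.
rewrite (@integral_change_of_weight _ _ _ _ _ _ R P P X X \1_A
  (cst (fine (P A))) mX mX _ _ _ _ _ idfun)//.
- under eq_integral do rewrite mulrC EFinM.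
  by rewrite integralZl//= X0 mule0.
- by move=> w; exact: fine_ge0.
- move=> B mB; rewrite integral_indic//; last exact: measurable_preim.
  apply: (etrans (AX _ mB)); rewrite PA.
  by rewrite (integral_cst P _ (fine (P A))%:E)//; exact: measurable_preim.
- exact: measurable_id.
Qed.

Lemma integrable_sqint (X : Omega -> R) : sqint P X ->
  P.-integrable setT (EFin \o X).
Proof.
move=> HX; apply/Lfun1_integrable.
by have := Lfun_subset12 (fin_num_measure P setT measurableT); apply.
Qed.

Lemma gaussian_centred (X : Omega -> R) (s : R) :
  s != 0 -> measurable_fun setT X ->
  (forall A : set R, measurable A -> P (X @^-1` A) = normal_prob 0 s A) ->
  sqint P X /\ (\int[P]_w (X w)%:E = 0)%E.
Proof.
move=> s0 mX law.
have H (f : R -> R) : measurable_fun setT f ->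
    (\int[P]_w (f (X w))%:E =
     \int[lebesgue_measure]_x (f x * normal_pdf 0 s x)%:E)%E.
  move=> mf; under eq_integral do rewrite -[f _]mulr1.
  apply: (@integral_change_of_weight _ _ _ (measurableTypeR R) _
    (measurableTypeR R) R P lebesgue_measure X idfun (cst 1)
    (normal_pdf 0 s) mX _ _ _ _ _ _ f mf) => //.
  - exact: measurable_id.
  - exact: measurable_normal_pdf.
  - by move=> x; exact: normal_pdf_ge0.
  - move=> A mA; rewrite (integral_cst P _ 1%:E); last exact: measurable_preim.
    by rewrite mul1e; exact: law.
split; last first.
  apply: (etrans (H idfun _)); first exact: measurable_id.
  exact: normal_mean0.
apply/sqintP; split=> //; rewrite (H (fun x => x ^+ 2))//.
exact: normal_second_moment.
Qed.

(** The events over which [b] integrates to zero form a Dynkin system; the total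
    integral being zero is what makes it stable under complement. *)
Lemma centred_on_generated (G : set (set Omega)) (b : Omega -> R) :
  (forall A, G A -> measurable A) -> setI_closed G ->
  P.-integrable setT (EFin \o b) -> (\int[P]_w (b w)%:E = 0)%E ->
  centred_on G b -> centred_on <<s G >> b.
Proof.
move=> mG IG ib b0 Gb A; rewrite -setI_closed_g_dynkin_g_sigma_algebra//.
suff: <<d G >> `<=` [set A | measurable A /\ (\int[P]_(w in A) (b w)%:E = 0)%E].
  by move=> /[apply] -[].
have ibS D : measurable D -> P.-integrable D (EFin \o b).
  by move=> mD; apply: integrableS ib.
apply: smallest_sub; last by move=> B GB; split; [exact: mG|exact: Gb].
split=> [|B [mB B0]|F tF FP].
- by split.
- split; first exact: measurableC.
  have := @integral_setU _ _ _ P B (~` B) (EFin \o b) mB (measurableC mB).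
  rewrite setUv => /(_ _ _) H.
  have := b0; rewrite H//=; last 2 first.
  + exact/measurable_int/ib.
  + by apply/disj_setPS; rewrite setICr.
  by rewrite B0 add0e.
- split; first by apply: bigcup_measurable => k _; have [] := FP k.
  rewrite integral_bigcup//=.
  + by rewrite eseries0// => k _ _; have [] := FP k.
  + by move=> k; have [] := FP k.
  + by apply: ibS; apply: bigcup_measurable => k _; have [] := FP k.
Qed.

(** The positive and negative parts of [b] put the same mass on every event
    [X @^-1` B], hence [X] has the same integral against both. *)
Lemma centred_mul (X b : Omega -> R) :
  sqint P X -> sqint P b ->
  (forall B : set R, measurable B ->
    (\int[P]_(w in X @^-1` B) (b w)%:E = 0)%E) ->
  (\int[P]_w (X w * b w)%:E = 0)%E.
Proof.
move=> HX Hb Xb.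
have mX := sqint_measurable HX; have mb := sqint_measurable Hb.
have ib := integrable_sqint Hb.
have bE w : b w = b^\+ w - b^\- w.
  rewrite /funrpos /funrneg; have [b0|b0] := leP (b w) 0.
    by rewrite max_l ?oppr_ge0// opprK add0r.
  by rewrite max_r ?subr0// oppr_le0 ltW.
have sq_part (g : Omega -> R) : measurable_fun setT g ->
    (forall w, `|g w| <= `|b w|) -> sqint P g.
  move=> mg gb; apply/sqintP; split=> //.
  apply: le_lt_trans ((sqintP P b).1 Hb).2.
  apply: le_integral_ge0 => w; rewrite lee_fin ?sqr_ge0//.
  rewrite -[leLHS]ger0_norm ?sqr_ge0// -[leRHS]ger0_norm ?sqr_ge0//.
  by rewrite !normrX lerXn2r// nnegrE.
have Hp : sqint P b^\+.
  apply: sq_part => [|w]; first exact: measurable_funrpos.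
  rewrite /funrpos ger0_norm ?le_max ?lexx ?orbT// ge_max normr_ge0 andbT.
  exact: ler_norm.
have Hm : sqint P b^\-.
  apply: sq_part => [|w]; first exact: measurable_funrneg.
  rewrite /funrneg ger0_norm ?le_max ?lexx ?orbT// ge_max normr_ge0 andbT.
  by rewrite -normrN; exact: ler_norm.
have eqpm B : measurable B ->
    (\int[P]_(w in X @^-1` B) (b^\+ w)%:E = \int[P]_(w in X @^-1` B) (b^\- w)%:E)%E.
  move=> mB; have mXB := measurable_preim mX mB.
  have ip := integrableS measurableT mXB (@subsetT _ _) (integrable_sqint Hp).
  have im := integrableS measurableT mXB (@subsetT _ _) (integrable_sqint Hm).
  have := Xb _ mB; under eq_integral do rewrite bE EFinB.
  rewrite integralB_EFin//.
  have := integrable_fin_num mXB ip; have := integrable_fin_num mXB im.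
  rewrite /=; case: (\int[P]_(x in X @^-1` B) (b^\+ x)%:E)%E => // r.
  case: (\int[P]_(x in X @^-1` B) (b^\- x)%:E)%E => // s _ _ [] rs.
  by congr EFin; lra.
under eq_integral do rewrite bE mulrBr EFinB.
rewrite integralB_EFin//; try exact: sqint_mul_integrable.
rewrite (@integral_change_of_weight _ _ _ _ _ _ R P P X X b^\+ b^\-
  mX mX _ _ _ _ eqpm idfun)//.
- by rewrite subee// integrable_fin_num//; exact: sqint_mul_integrable.
- exact: measurable_funrpos.
- exact: measurable_funrneg.
- exact: measurable_id.
Qed.
End centred.

(** * Mean-square limits *)
Section L2_limits.
Context (R : realType) d (Omega : measurableType d) (P : probability Omega R).

(** Along a subsequence with mean-square errors at most [2 ^ - (k + 1)], the sum
    of the squared errors is integrable, hence almost surely finite. *)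
Lemma L2_cvg_ae_subseq (S : nat -> Omega -> R) (b : Omega -> R) :
  (forall n, measurable_fun setT (S n)) -> measurable_fun setT b ->
  (\int[P]_w ((b w - S n w) ^+ 2)%:E)%E @[n --> \oo] --> 0%E ->
  exists g : nat -> nat, {ae P, forall w, S (g m) w @[m --> \oo] --> b w}.
Proof.
move=> mS mb cvg0.
have [g Hg] : {g : nat -> nat & forall k,
    (\int[P]_w ((b w - S (g k) w) ^+ 2)%:E <= (1 / (2 ^ (k + 1))%:R)%:E)%E}.
  apply: (@choice nat nat (fun k n => (\int[P]_w ((b w - S n w) ^+ 2)%:E
    <= (1 / (2 ^ (k + 1))%:R)%:E)%E)) => k.
  have e0 : 0 < 1 / (2 ^ (k + 1))%:R :> R by rewrite divr_gt0// ltr0n expn_gt0.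
  have /fine_cvgP[_ /cvgr0Pnorm_lt /(_ _ e0)] := cvg0.
  have /fine_cvgP[fin _] := cvg0.
  move=> /(filterI fin) [n _ /(_ n (leqnn _))] [f1 f2]; exists n.
  rewrite -(fineK f1) lee_fin; apply: le_trans (ltW f2).
  exact: ler_norm.
exists g.
pose f k w := ((b w - S (g k) w) ^+ 2)%:E.
have f0 k w : (0 <= f k w)%E by rewrite lee_fin sqr_ge0.
have mf k : measurable_fun setT (f k).
  by apply/measurable_EFinP/measurable_funX/measurable_funB.
have isum : (\int[P]_w \sum_(0 <= k <oo) f k w < +oo)%E.
  rewrite integral_nneseries//.
  apply: (@le_lt_trans _ _ (\sum_(0 <= k <oo) (1 / (2 ^ (k + 1))%:R)%:E)%E).
    by apply: lee_nneseries => [k _ _|k _]; [exact: integral_ge0|exact: Hg].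
  by rewrite (cvg_lim _ (@cvg_geometric_eseries_half R 1 0))// ltry.
have msum : measurable_fun setT (fun w => \sum_(0 <= k <oo) f k w)%E.
  exact: ge0_emeasurable_sum.
have : P.-integrable setT (fun w => \sum_(0 <= k <oo) f k w)%E.
  apply/integrableP; split=> //; apply: le_lt_trans isum.
  apply: le_integral_ge0 => // w; rewrite gee0_abs//.
  by apply: nneseries_ge0 => k _ _.
move=> /(integrable_ae measurableT); apply: filterS => w /(_ I) fw.
have fwoo : (\sum_(0 <= k <oo) f k w < +oo)%E.
  by move: fw; rewrite fin_numE => /andP[_]; rewrite ltey.
have tail := nneseries_tail_cvg fwoo (fun k _ => f0 k w).
have : f k w @[k --> \oo] --> 0%E.
  apply: (squeeze_cvge _ (cvg_cst 0%E) tail).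
  apply: nearW => k; rewrite f0/=.
  have := @nneseries_lim_ge R (fun k => f k w) xpredT k k.+1 (fun i _ _ => f0 i w).
  by rewrite big_nat1.
move=> /fine_cvgP[_ /cvgr0Pnorm_lt fw0].
apply/cvgrPdist_lt => e e0.
have := fw0 _ (exprn_gt0 2 e0); apply: filterS => k /=.
rewrite normrX => he; rewrite -(@ltr_pXn2r _ 2)// ?nnegrE//; exact: ltW.
Qed.

(** The superior limit of an almost surely convergent subsequence is measurable
    for the smaller sigma-algebra, and it is almost surely equal to [b]: events
    of [b] are events of the approximations up to a null set. *)
Lemma L2_limit_version (G : set (set Omega)) (S : nat -> Omega -> R)
    (b : Omega -> R) :
  <<s G >> `<=` measurable ->
  (forall n (B : set R), measurable B -> <<s G >> (S n @^-1` B)) ->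
  measurable_fun setT b ->
  (\int[P]_w ((b w - S n w) ^+ 2)%:E)%E @[n --> \oo] --> 0%E ->
  forall B : set R, measurable B -> exists2 A, <<s G >> A &
    {ae P, forall w, (b @^-1` B) w <-> A w}.
Proof.
move=> Gm GS mb cvg0 B mB.
have mS n : measurable_fun setT (S n).
  by move=> _ C mC; rewrite setTI; apply: Gm; exact: GS.
have [g Hg] := L2_cvg_ae_subseq mS mb cvg0.
pose b' w := fine (limn_esup (fun m => (S (g m) w)%:E)).
have mb' : measurable_fun (setT : set (g_sigma_algebraType G)) b'.
  apply: (measurableT_comp (fine_measurable measurableT)).
  apply: measurable_fun_limn_esup => m; apply/measurable_EFinP.
  by move=> _ C mC; rewrite setTI; exact: GS.
exists (b' @^-1` B).
  by have := mb' measurableT B mB; rewrite setTI.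
apply: filterS Hg => w /= Hw.
suff -> : b' w = b w by [].
rewrite /b'; suff -> : limn_esup (fun m => (S (g m) w)%:E) = (b w)%:E by [].
have /cvg_limn_einf_sup[_ //] : (S (g m) w)%:E @[m --> \oo] --> (b w)%:E.
by apply/fine_cvgP; split; [exact: nearW|exact: Hw].
Qed.

(** By Cauchy-Schwarz, the integral of [b - S n] over [A] is bounded by the
    mean-square error. *)
Lemma L2_limit_centred (A : set Omega) (S : nat -> Omega -> R) (b : Omega -> R) :
  measurable A -> (forall n, sqint P (S n)) -> sqint P b ->
  (\int[P]_w ((b w - S n w) ^+ 2)%:E)%E @[n --> \oo] --> 0%E ->
  (forall n, (\int[P]_(w in A) (S n w)%:E = 0)%E) ->
  (\int[P]_(w in A) (b w)%:E = 0)%E.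
Proof.
move=> mA HS Hb cvg0 SA.
have HA : sqint P \1_A.
  apply/sqintP; split; first exact: measurable_indic.
  rewrite (_ : (fun x => _) = (fun x => (\1_A x)%:E)); last first.
    by apply/funext => w; rewrite indicE; case: (_ \in _); rewrite ?expr0n ?expr1n.
  by rewrite integral_indic// setIT (le_lt_trans (probability_le1 P mA))// ltry.
have E f : sqint P f -> (\int[P]_(w in A) (f w)%:E = (dot P \1_A f)%:E)%E.
  move=> Hf; rewrite -dotE// integral_set_indic.
  by apply: eq_integral => w _; rewrite mulrC.
rewrite E//; congr EFin.
have S0 n : dot P \1_A (S n) = 0 by have := SA n; rewrite E// => -[].
have bound n : (((dot P \1_A b) ^+ 2)%:E <= \int[P]_w ((b w - S n w) ^+ 2)%:E)%E.
  have HbS := sqintB Hb (HS n).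
  under eq_integral do rewrite expr2.
  rewrite dotE// lee_fin.
  have <- : dot P \1_A (fun w => b w - S n w) = dot P \1_A b.
    by rewrite dotC dotBl// (dotC _ (S n)) S0 subr0 dotC.
  apply: le_trans (dot_CS HA HbS) _; rewrite ler_piMl ?dot_ge0//.
  rewrite -lee_fin -dotE//; apply: le_trans (probability_le1 P mA).
  rewrite -[X in (_ <= P X)%E]setIT -integral_indic//.
  apply: le_integral_ge0 => w; rewrite lee_fin ?mulr_ge0// indicE.
  by case: (_ \in _); rewrite ?mulr1 ?mulr0.
have := lime_ge (cvgP _ cvg0) (nearW _ bound).
rewrite (cvg_lim _ cvg0)// lee_fin => H.
by apply/eqP; rewrite -sqrf_eq0 eq_le H sqr_ge0.
Qed.

End L2_limits.

(** * Independence of the noise from the past *)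
Section noise_model.
Context (R : realType) d (Omega : measurableType d) (P : probability Omega R).
(** [delta j k] stands for the increment of the [j]-th Brownian motion over the
    [k]-th time step, and [b k i] for the noise of step [k] tested with the
    [i]-th function, a mean-square limit of combinations of the [delta j k]. *)
Variable delta : nat -> nat -> Omega -> R.

Definition rectangle (M n : nat) (B : nat -> nat -> set R) : set Omega :=
  [set w | forall j k, (j < M)%N -> (k < n)%N -> B j k (delta j k w)].

(** A pi-system which generates the sigma-algebra of the steps before [n].  With
    rectangles rather than arbitrary finite families of events, the
    intersection of two members is obtained by enlarging the range of [j]. *)
Definition past (n : nat) : set (set Omega) :=
  [set A | exists M B, (forall j k, measurable (B j k)) /\ A = rectangle M n B].

Hypothesis delta_sqint : forall j k, sqint P (delta j k).
Hypothesis delta_mean0 : forall j k, (\int[P]_w (delta j k w)%:E = 0)%E.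
Hypothesis delta_rect : forall M n B, (forall j k, measurable (B j k)) ->
  P (rectangle M n B) =
    (\prod_(0 <= j < M) \prod_(0 <= k < n) P (delta j k @^-1` B j k))%E.

Lemma past_measurable n A : past n A -> measurable A.
Proof.
move=> [M [B [mB ->]]].
have -> : rectangle M n B = \bigcap_j \bigcap_k
    (if (j < M)%N && (k < n)%N then delta j k @^-1` B j k else setT).
  apply/seteqP; split=> [w Hw j _ k _|w Hw j k jM kn].
    by case: ifPn => [/andP[]|//]; exact: Hw.
  by have := Hw j I k I; rewrite jM kn.
apply: bigcapT_measurable => j; apply: bigcapT_measurable => k.
case: ifP => // _; apply: measurable_preim => //.
exact: sqint_measurable (delta_sqint j k).
Qed.

Lemma past_setI_closed n : setI_closed (past n).
Proof.
move=> _ _ [M1 [B1 [mB1 ->]]] [M2 [B2 [mB2 ->]]].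
exists (maxn M1 M2), (fun j k => (if (j < M1)%N then B1 j k else setT) `&`
  (if (j < M2)%N then B2 j k else setT)); split.
  by move=> j k; apply: measurableI; case: ifP.
apply/seteqP; split=> [w [H1 H2] j k jM kn|w Hw].
  by split; case: ifPn => // jM'; [exact: H1|exact: H2].
split=> j k jM kn.
  have jM' : (j < maxn M1 M2)%N by rewrite leq_max jM.
  by have [] := Hw j k jM' kn; rewrite jM.
have jM' : (j < maxn M1 M2)%N by rewrite leq_max jM orbT.
by have [_] := Hw j k jM' kn; rewrite jM.
Qed.

Lemma past_delta n j k (B : set R) : (k < n)%N -> measurable B ->
  past n (delta j k @^-1` B).
Proof.
move=> kn mB.
exists j.+1, (fun j' k' => if (j' == j) && (k' == k) then B else setT); split.
  by move=> j' k'; case: ifP.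
apply/seteqP; split=> [w wB j' k' _ _|w Hw].
  by case: ifPn => // /andP[/eqP -> /eqP ->].
by have := Hw j k (leqnn _) kn; rewrite !eqxx.
Qed.

(** Both events, and their intersection, are rectangles of the same shape once
    sides equal to the whole line are added, and the sides of the two events
    are never both proper. *)
Lemma past_indep n j0 (C : set R) A : measurable C -> past n A ->
  P (A `&` delta j0 n @^-1` C) = (P A * P (delta j0 n @^-1` C))%E.
Proof.
move=> mC [M [B [mB ->]]].
pose M' := maxn M j0.+1.
pose B1 j k := if (j < M)%N && (k < n)%N then B j k else setT.
pose B2 j k := if (j == j0) && (k == n) then C else setT.
have mB1 j k : measurable (B1 j k) by rewrite /B1; case: ifP.
have mB2 j k : measurable (B2 j k) by rewrite /B2; case: ifP.
have mB12 j k : measurable (B1 j k `&` B2 j k) by exact: measurableI.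
have j0M : (j0 < M')%N by rewrite leq_max leqnn orbT.
have E1 : rectangle M n B = rectangle M' n.+1 B1.
  apply/seteqP; split=> [w Hw j k _ _|w Hw j k jM kn].
    by rewrite /B1; case: ifPn => // /andP[]; exact: Hw.
  have jM' : (j < M')%N by rewrite leq_max jM.
  by have := Hw j k jM' (ltnW kn); rewrite /B1 jM kn.
have E2 : delta j0 n @^-1` C = rectangle M' n.+1 B2.
  apply/seteqP; split=> [w wC j k _ _|w Hw].
    by rewrite /B2; case: ifPn => // /andP[/eqP -> /eqP ->].
  by have := Hw j0 n j0M (leqnn _); rewrite /B2 !eqxx.
have E3 : rectangle M n B `&` delta j0 n @^-1` C =
    rectangle M' n.+1 (fun j k => B1 j k `&` B2 j k).
  rewrite E1 E2; apply/seteqP; split=> [w [H1 H2] j k jM kn|w Hw].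
    by split; [exact: H1|exact: H2].
  by split=> j k jM kn; have [] := Hw j k jM kn.
rewrite E3 E1 E2 !delta_rect// -big_split/=; apply: eq_bigr => j _.
rewrite -big_split/=; apply: eq_bigr => k _.
rewrite /B1 /B2; case: (ltnP k n) => kn.
  by rewrite [k == n](ltn_eqF kn) andbF setIT preimage_setT probability_setT mule1.
by rewrite andbF setTI preimage_setT probability_setT mul1e.
Qed.

Lemma past_centred n j0 : centred_on P <<s past n >> (delta j0 n).
Proof.
apply: centred_on_generated => //.
- exact: past_measurable.
- exact: past_setI_closed.
- exact: integrable_sqint.
- move=> A pA; apply: centred_indep => //.
  + exact: past_measurable pA.
  + exact: integrable_sqint.
  + by move=> B mB; exact: past_indep.
Qed.

Variables (I : Type) (b : nat -> I -> Omega -> R).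
Hypothesis b_approx : forall k i, exists c : nat -> R,
  (\int[P]_w ((b k i w - \sum_(j < n) c j * delta j k w) ^+ 2)%:E)%E
    @[n --> \oo] --> 0%E.
Hypothesis b_meas : forall k i, measurable_fun setT (b k i).

Let combination k (c : nat -> R) n w := \sum_(j < n) c j * delta j k w.

Let combination_sqint k c n : sqint P (combination k c n).
Proof. by apply: sqint_sum => j; exact: sqint_scale. Qed.

Lemma noise_sqint k i : sqint P (b k i).
Proof.
have [c /fine_cvgP[[n _ fin] _]] := b_approx k i.
have Hd : sqint P (fun w => b k i w - combination k c n w).
  apply/sqintP; split.
    by apply: measurable_funB => //; exact: sqint_measurable.
  by rewrite ltey_eq fin//=.
have := sqintD Hd (combination_sqint k c n).
by under eq_fun do rewrite subrK.
Qed.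

Lemma sub_sigma_measurable (G : set (set Omega)) :
  (forall A, G A -> measurable A) -> <<s G >> `<=` measurable.
Proof. by move=> Gm; apply: smallest_sub => //; exact: sigma_algebra_measurable. Qed.

Lemma noise_past_centred n i : centred_on P <<s past n >> (b n i).
Proof.
move=> A sA; have [c cvg0] := b_approx n i.
have mA : measurable A by exact: (sub_sigma_measurable (@past_measurable n) sA).
apply: (L2_limit_centred mA _ (noise_sqint n i) cvg0) => m.
  exact: combination_sqint.
transitivity (\int[P]_(w in A) (\sum_(j < m) (c j * delta j n w)%:E))%E.
  by apply: eq_integral => w _; rewrite sumEFin.
have iA j : P.-integrable A (EFin \o delta j n).
  by apply: integrableS (integrable_sqint (delta_sqint j n)).
rewrite integral_sum//; last first.
  by move=> j; exact: (integrableZl mA (c j) (iA j)).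
rewrite big1// => j _; under eq_integral do rewrite EFinM.
rewrite (integralZl mA (iA j)) (_ : integral _ _ _ = 0)%E ?mule0//.
exact: (@past_centred n j A sA).
Qed.

Lemma noise_past_version n k i (B : set R) : (k < n)%N -> measurable B ->
  exists2 A, <<s past n >> A & {ae P, forall w, (b k i @^-1` B) w <-> A w}.
Proof.
move=> kn mB; have [c cvg0] := b_approx k i.
apply: (L2_limit_version _ _ _ cvg0) => //.
  exact: (sub_sigma_measurable (@past_measurable n)).
move=> m C mC.
have : measurable_fun (setT : set (g_sigma_algebraType (past n)))
    (combination k c m).
  apply: measurable_sum => j; apply: measurable_funM => //.
  move=> _ D mD; rewrite setTI; apply: sub_sigma_algebra.
  exact: past_delta.
by move=> /(_ measurableT C mC); rewrite setTI.
Qed.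

Variables (G0 GW : set (set Omega)).
Hypothesis G0_measurable : forall A, G0 A -> measurable A.
Hypothesis GW_measurable : forall A, GW A -> measurable A.
Hypothesis G0_indep_GW : independent P <<s G0 >> <<s GW >>.
Hypothesis b_GW : forall k i (B : set R), measurable B ->
  <<s GW >> (b k i @^-1` B).

(** [G0] generates the events of the initial datum and [GW] those of [W].
    Independence from the initial datum is available for events of [W], and
    independence from the next step for events of the Brownian motions.
    Neither family contains the other: a Brownian motion whose eigenvalue is
    zero cannot be recovered from [W], and [W] is a function of the Brownian
    motions only up to null sets.  Hence the double requirement on [A1]. *)
Definition history (n : nat) : set (set Omega) :=
  [set A | exists A0 A1, [/\ <<s G0 >> A0, <<s GW >> A1,
    exists2 A', <<s past n >> A' & {ae P, forall w, A1 w <-> A' w} &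
    A = A0 `&` A1]].

Let F0m := sub_sigma_measurable G0_measurable.
Let FWm := sub_sigma_measurable GW_measurable.

Lemma history_measurable n A : history n A -> measurable A.
Proof.
by move=> [A0 [A1 [HA0 HA1 _ ->]]]; apply: measurableI; [exact: F0m|exact: FWm].
Qed.

Lemma history_setI_closed n : setI_closed (history n).
Proof.
move=> _ _ [A0 [A1 [HA0 HA1 [A' HA' eA] ->]]] [B0 [B1 [HB0 HB1 [B' HB' eB] ->]]].
exists (A0 `&` B0), (A1 `&` B1); split.
- exact: (@measurableI _ (g_sigma_algebraType G0)).
- exact: (@measurableI _ (g_sigma_algebraType GW)).
- exists (A' `&` B'); first exact: (@measurableI _ (g_sigma_algebraType (past n))).
  apply: filterS2 eA eB => w [a1 a2] [b1 b2].
  by split=> -[? ?]; split; auto.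
- by rewrite setIACA.
Qed.

Lemma history_initial n A : <<s G0 >> A -> <<s history n >> A.
Proof.
move=> HA; apply: sub_sigma_algebra; exists A, setT; split=> //.
- exact: (@measurableT _ (g_sigma_algebraType GW)).
- exists setT; first exact: (@measurableT _ (g_sigma_algebraType (past n))).
  exact: nearW.
- by rewrite setIT.
Qed.

Lemma history_noise n k i (B : set R) : (k < n)%N -> measurable B ->
  <<s history n >> (b k i @^-1` B).
Proof.
move=> kn mB; apply: sub_sigma_algebra; exists setT, (b k i @^-1` B); split=> //.
- exact: (@measurableT _ (g_sigma_algebraType G0)).
- exact: b_GW.
- exact: noise_past_version.
- by rewrite setTI.
Qed.

Lemma noise_centred n i : (\int[P]_w (b n i w)%:E = 0)%E.
Proof.
apply: (noise_past_centred i (A := setT) (n := n)).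
exact: (@measurableT _ (g_sigma_algebraType (past n))).
Qed.

(** The event of the initial datum splits off by independence.  What remains is
    the integral over an event of [W], which may be replaced by the event of
    the past that it coincides with almost surely. *)
Lemma history_centred n i : centred_on P <<s history n >> (b n i).
Proof.
have ib := integrable_sqint (noise_sqint n i).
apply: centred_on_generated => //.
- exact: history_measurable.
- exact: history_setI_closed.
- exact: noise_centred.
move=> _ [A0 [A1 [HA0 HA1 [A' HA' eA] ->]]].
have mA0 := F0m HA0; have mA1 := FWm HA1.
have mA' : measurable A' by exact: (sub_sigma_measurable (@past_measurable n) HA').
rewrite integral_mkcondr.
have E : ((fun w => (b n i w)%:E) \_ A1 = EFin \o (fun w => b n i w * \1_A1 w)%R)%E.
  apply/funext => w; rewrite patchE /= indicE.
  by case: ifP; rewrite ?mulr1 ?mulr0.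
rewrite E; apply: centred_indep => //.
- by rewrite -E; apply/(integrable_mkcond _ mA1)/(integrableS measurableT).
- rewrite -integral_set_indic -(noise_past_centred i HA').
  rewrite integral_mkcond [RHS]integral_mkcond; apply: ae_eq_integral => //.
  + by apply/(measurable_restrictT _ _).1 => //; exact/measurable_EFinP/measurable_funTS.
  + by apply/(measurable_restrictT _ _).1 => //; exact/measurable_EFinP/measurable_funTS.
  + apply: filterS eA => w [a1 a2] _; rewrite !patchE.
    by congr (if _ then _ else _); apply/idP/idP; rewrite !inE.
- move=> B mB; apply: G0_indep_GW => //.
  have : measurable_fun (setT : set (g_sigma_algebraType GW))
      (fun w => b n i w * \1_A1 w).
    apply: measurable_funM.
      by move=> _ D mD; rewrite setTI; exact: b_GW.
    exact: measurable_indic.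
  by move=> /(_ measurableT B mB); rewrite setTI.
Qed.

End noise_model.

(** * The inner product of L^2(0,1) *)
Section L2_inner_product.
Context (R : realType).
Implicit Types f g h : L2 R.

Lemma ipE (f g : R -> R) : ip f g = dot (leb01 R) f g.
Proof. by []. Qed.

Lemma L2_sqint f : sqint (leb01 R) f.
Proof. exact: LfunP. Qed.

Lemma L2_subE f g : ((f - g : L2 R) : R -> R) = fun x => f x - g x.
Proof. by []. Qed.

Lemma L2_sumE n (c : nat -> R) (e : nat -> L2 R) :
  ((\sum_(j < n) c j *: e j : L2 R) : R -> R) =
  fun x => \sum_(j < n) c j * e j x.
Proof.
apply/funext => x; elim: n => [|n IH]; first by rewrite !big_ord0.
by rewrite !big_ord_recr/= -IH.
Qed.

Lemma ip_subl f g h : ip (f - g : L2 R) h = ip f h - ip g h.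
Proof. by rewrite !ipE L2_subE dotBl//; exact: L2_sqint. Qed.

Lemma ip_suml n (c : nat -> R) (e : nat -> L2 R) h :
  ip (\sum_(j < n) c j *: e j : L2 R) h = \sum_(j < n) c j * ip (e j) h.
Proof.
rewrite !ipE L2_sumE dot_suml.
- by apply: eq_bigr => j _; rewrite dotZl//; exact: L2_sqint.
- by move=> j; apply: sqint_scale; exact: L2_sqint.
- exact: L2_sqint.
Qed.

Lemma L2norm_sq (f : R -> R) : L2norm f ^+ 2 = ip f f.
Proof. by rewrite /L2norm sqr_sqrtr// ipE dot_ge0. Qed.

Lemma ip_CS f g : ip f g ^+ 2 <= ip f f * ip g g.
Proof. by rewrite !ipE; apply: dot_CS; exact: L2_sqint. Qed.

End L2_inner_product.

(** * Increments of a Q-Wiener process *)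
Section wiener.
Context (R : realType) d (Omega : measurableType d) (P : probability Omega R).
Variables (e : nat -> L2 R) (gamma : nat -> R).
Variables (beta : nat -> R -> Omega -> R) (W : R -> Omega -> L2 R).
Variable tau : R.
Hypothesis tau_gt0 : 0 < tau.
Hypothesis HW : Q_wiener P e gamma beta W.

Definition brownian_step j k w := beta j (k.+1%:R * tau) w - beta j (k%:R * tau) w.

Definition wiener_step k (f : L2 R) w :=
  ip (W (k.+1%:R * tau) w) f - ip (W (k%:R * tau) w) f.

Let time_ge0 k : 0 <= k%:R * tau.
Proof. by rewrite mulr_ge0// ltW. Qed.

Let time_lt k : k%:R * tau < k.+1%:R * tau.
Proof. by rewrite ltr_pM2r// ltr_nat. Qed.

Lemma brownian_step_measurable j k : measurable_fun setT (brownian_step j k).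
Proof.
have [bm _ _ _ _] := wiener_brownian HW j.
by apply: measurable_funB; exact: bm.
Qed.

Lemma brownian_step_centred j k :
  sqint P (brownian_step j k) /\ (\int[P]_w (brownian_step j k w)%:E = 0)%E.
Proof.
have [_ _ _ gauss _] := wiener_brownian HW j.
apply: (@gaussian_centred _ _ _ _ _
  (Num.sqrt (k.+1%:R * tau - k%:R * tau))).
- by rewrite gt_eqF// sqrtr_gt0 subr_gt0.
- exact: brownian_step_measurable.
- by move=> A mA; exact: (gauss _ _ (time_ge0 k) (time_lt k) A mA).
Qed.

Lemma wiener_step_measurable k f : measurable_fun setT (wiener_step k f).
Proof. by apply: measurable_funB; apply: (wiener_measurable HW). Qed.

Lemma sigma_generatedP (I : Type) (D : set I) (X : I -> Omega -> R) i (B : set R) :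
  D i -> measurable B -> sigma_generated D X (X i @^-1` B).
Proof.
move=> Di mB; apply: sub_sigma_algebra; exists i => //.
by exists B => //; rewrite setTI.
Qed.

(** The product over [j] comes from the independence of the Brownian motions, the
    product over [k] from the independence of the increments of each. *)
Lemma brownian_step_rect M n B : (forall j k, measurable (B j k)) ->
  P (rectangle brownian_step M n B) =
    (\prod_(0 <= j < M) \prod_(0 <= k < n) P (brownian_step j k @^-1` B j k))%E.
Proof.
move=> mB.
pose E j k := brownian_step j k @^-1` B j k.
have iotaE m : [set` iota 0 m] = [set j | (j < m)%N].
  by apply/seteqP; split=> j /=; rewrite mem_iota add0n.
have -> : rectangle brownian_step M n B =
    \bigcap_(j in [set` iota 0 M]) \bigcap_(k in [set` iota 0 n]) E j k.
  rewrite !iotaE; apply/seteqP; split=> [w Hw j jM k kn|w Hw j k jM kn].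
    exact: Hw.
  exact: Hw.
rewrite (wiener_independent HW (iota_uniq 0 M)); last first.
  move=> j _.
  set G := sigma_generated _ _.
  pose gG := \bigcup_(i in [set t : R | 0 <= t])
    preimage_set_system setT (beta j i) measurable.
  suff mE k : G (E j k).
    have -> : \bigcap_(k in [set` iota 0 n]) E j k =
        \bigcap_k (if (k < n)%N then E j k else setT).
      rewrite iotaE; apply/seteqP; split=> [w Hw k _|w Hw k kn].
        by case: ifPn => //; exact: Hw.
      by have := Hw k I; rewrite kn.
    apply: (@bigcapT_measurable _ (g_sigma_algebraType gG)) => k.
    by case: ifP => // _; exact: mE.
  have mb t : 0 <= t ->
      measurable_fun (setT : set (g_sigma_algebraType gG)) (beta j t).
    by move=> t0 _ C mC; rewrite setTI; exact: sigma_generatedP.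
  have : measurable_fun (setT : set (g_sigma_algebraType gG)) (brownian_step j k).
    by apply: measurable_funB; exact: mb.
  by move=> /(_ measurableT _ (mB j k)); rewrite setTI.
rewrite /index_iota subn0; apply: eq_bigr => j _.
have [_ _ indep _ _] := wiener_brownian HW j.
rewrite subn0.
rewrite (indep (fun k => k%:R * tau) _ _ _ _ (iota_uniq 0 n))//=.
- by move=> k; rewrite ltW.
- move=> k _.
  exact: (@sigma_generatedP unit setT (fun=> brownian_step j k) tt).
Qed.

(** Tested with [f], the remainder of the series of [W(t)] has a second moment
    which is at most [|f|^2] times its mean square. *)
Lemma wiener_ip_cvg t (f : L2 R) : 0 <= t ->
  (\int[P]_w ((ip (W t w) f - \sum_(j < n)
     (Num.sqrt (gamma j) * ip (e j) f) * beta j t w) ^+ 2)%:E)%E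
  @[n --> \oo] --> 0%E.
Proof.
move=> t0.
have cvg0 := wiener_series HW t0.
have cvg1 := cvgeZl (isT : ((ip f f)%:E \is a fin_num)%E) cvg0.
rewrite mule0 in cvg1.
apply: (squeeze_cvge _ (cvg_cst 0%E) cvg1).
apply: nearW => n; apply/andP; split.
  by apply: integral_ge0 => w _; rewrite lee_fin sqr_ge0.
pose c := ip f f; have c0 : 0 <= c by rewrite /c ipE dot_ge0.
pose D w := ip (W t w) f -
  \sum_(j < n) (Num.sqrt (gamma j) * ip (e j) f) * beta j t w.
pose V w : L2 R := W t w - \sum_(j < n) (Num.sqrt (gamma j) * beta j t w) *: e j.
have mD : measurable_fun setT D.
  apply: measurable_funB; first exact: (wiener_measurable HW).
  apply: measurable_sum => j; apply: measurable_funM => //.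
  by have [bm _ _ _ _] := wiener_brownian HW j; exact: bm.
have DV w : D w ^+ 2 <= c * L2norm (V w) ^+ 2.
  suff -> : D w = ip (V w) f by rewrite L2norm_sq mulrC; exact: ip_CS.
  rewrite /V ip_subl (ip_suml n (fun j => Num.sqrt (gamma j) * beta j t w)) /D.
  congr (_ - _).
  by apply: eq_bigr => j _; ring.
(* The constant [c] is moved to the side of [D], which is plainly measurable;
   for the norm of the remainder [V] this would rest on Parseval's identity. *)
have cD w : D w ^+ 2 = c * (D w ^+ 2 / c).
  have [c00|c00] := eqVneq c 0; last by field.
  by have := DV w; have := sqr_ge0 (D w); rewrite c00 !mul0r; lra.
under eq_integral do rewrite -/(D _) cD EFinM.
rewrite ge0_integralZl//; last 2 first.
- apply/measurable_EFinP; apply: measurable_funM => //.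
  exact: measurable_funX.
- by move=> w _; rewrite lee_fin divr_ge0 ?sqr_ge0.
rewrite lee_wpmul2l ?lee_fin// /mean_sqnorm unlock.
apply: le_integral_ge0 => w; rewrite lee_fin ?divr_ge0 ?sqr_ge0//.
have [c00|c00] := eqVneq c 0; first by rewrite c00 invr0 mulr0 sqr_ge0.
by rewrite ler_pdivrMr ?lt_neqAle 1?eq_sym ?c00// mulrC DV.
Qed.

Lemma wiener_step_approx k (f : L2 R) : exists c : nat -> R,
  (\int[P]_w ((wiener_step k f w -
     \sum_(j < n) c j * brownian_step j k w) ^+ 2)%:E)%E
  @[n --> \oo] --> 0%E.
Proof.
exists (fun j => Num.sqrt (gamma j) * ip (e j) f).
pose D t n w := ip (W t w) f -
  \sum_(j < n) (Num.sqrt (gamma j) * ip (e j) f) * beta j t w.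
have mD t n : 0 <= t -> measurable_fun setT (D t n).
  move=> t0; apply: measurable_funB; first exact: (wiener_measurable HW).
  apply: measurable_sum => j; apply: measurable_funM => //.
  by have [bm _ _ _ _] := wiener_brownian HW j; exact: bm.
pose I t n := (\int[P]_w ((D t n w) ^+ 2)%:E)%E.
have cvg t : 0 <= t -> (2%:E * I t n)%E @[n --> \oo] --> 0%E.
  by move=> t0; rewrite -(mule0 2%:E); apply: cvgeZl => //; exact: wiener_ip_cvg.
have := cvgeD _ (cvg _ (time_ge0 k.+1)) (cvg _ (time_ge0 k)).
rewrite adde0 => /(_ _ isT) cvg2.
apply: (squeeze_cvge _ (cvg_cst 0%E) cvg2).
apply: nearW => n; apply/andP; split.
  by apply: integral_ge0 => w _; rewrite lee_fin sqr_ge0.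
have mD2 t : 0 <= t -> measurable_fun setT (fun w => (D t n w ^+ 2)%:E).
  by move=> t0; apply/measurable_EFinP/measurable_funX/mD.
rewrite /= /I -!ge0_integralZl//; try exact: mD2; try by
  move=> w _; rewrite lee_fin sqr_ge0.
rewrite -ge0_integralD//; try (by move=> w _; rewrite mule_ge0 ?lee_fin ?sqr_ge0);
  try (by apply: emeasurable_funM => //; exact: mD2).
apply: le_integral_ge0 => w; rewrite ?lee_fin ?sqr_ge0//.
have -> : wiener_step k f w - \sum_(j < n) Num.sqrt (gamma j) * ip (e j) f *
    brownian_step j k w = D (k.+1%:R * tau) n w - D (k%:R * tau) n w.
  have -> : \sum_(j < n) Num.sqrt (gamma j) * ip (e j) f * brownian_step j k w =
      \sum_(j < n) Num.sqrt (gamma j) * ip (e j) f * beta j (k.+1%:R * tau) w -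
      \sum_(j < n) Num.sqrt (gamma j) * ip (e j) f * beta j (k%:R * tau) w.
    by rewrite -sumrB; apply: eq_bigr => j _; rewrite /brownian_step; ring.
  by rewrite /D /wiener_step; ring.
have := sqr_ge0 (D (k.+1%:R * tau) n w + D (k%:R * tau) n w); nra.
Qed.

Definition L2_generators I (D : set I) (X : I -> Omega -> R -> R) :
    set (set Omega) :=
  \bigcup_(p in [set p : I * L2 R | D p.1])
    preimage_set_system setT (fun w => ip (X p.1 w) p.2) measurable.

Lemma L2_generators_measurable I (D : set I) (X : I -> Omega -> R -> R) :
  (forall i, D i -> L2_measurable (X i)) ->
  forall A, L2_generators D X A -> measurable A.
Proof. by move=> mX A [[i f] /= Di [B mB <-]]; apply: mX. Qed.

Lemma wiener_step_sigma k f (B : set R) : measurable B ->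
  L2_sigma [set t : R | 0 <= t] W (wiener_step k f @^-1` B).
Proof.
move=> mB.
pose G := L2_generators [set t : R | 0 <= t] W.
have mW t : 0 <= t ->
    measurable_fun (setT : set (g_sigma_algebraType G)) (fun w => ip (W t w) f).
  move=> t0 _ C mC; rewrite setTI.
  exact: (@sigma_generatedP _ [set p : R * L2 R | [set t : R | 0 <= t] p.1]
    (fun p w => ip (W p.1 w) p.2) (t, f) C t0 mC).
have : measurable_fun (setT : set (g_sigma_algebraType G)) (wiener_step k f).
  by apply: measurable_funB; exact: mW.
by move=> /(_ measurableT _ mB); rewrite setTI.
Qed.

End wiener.

(** * The finite element space *)
Section finite_elements.
Context (R : realType) (N : nat).
Hypothesis N_gt0 : (0 < N)%N.
Implicit Types (v : R -> R) (x : R).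

Let NR : 0 < N%:R :> R. Proof. by rewrite ltr0n. Qed.

Definition node (j : nat) : R := j%:R / N%:R.

Definition hat (j : nat) (x : R) : R := Num.max 0 (1 - `|N%:R * x - j%:R|).

Let scale_node j : N%:R * node j = j%:R.
Proof. by rewrite /node mulrCA divff ?mulr1// gt_eqF. Qed.

Lemma node_le j k : (node j <= node k) = (j <= k)%N.
Proof. by rewrite /node ler_pM2r ?ler_nat// invr_gt0. Qed.

Lemma node0 : node 0 = 0.
Proof. by rewrite /node mul0r. Qed.

Lemma nodeN : node N = 1.
Proof. by rewrite /node divff// gt_eqF. Qed.

Lemma hat_ge0 j x : 0 <= hat j x.
Proof. by rewrite /hat le_max lexx. Qed.

Lemma hat_le1 j x : hat j x <= 1.
Proof. by rewrite /hat ge_max ler01/= gerBl normr_ge0. Qed.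

Lemma hat_node j k : hat j (node k) = (j == k)%:R.
Proof.
rewrite /hat scale_node; have [->|jk] := eqVneq j k.
  by rewrite subrr normr0 subr0 max_r.
rewrite max_l// subr_le0.
rewrite -[k%:R]/(k%:~R) -[j%:R]/(j%:~R) -intrB -intr_norm.
rewrite -[1]/(1%:~R) ler_int.
by rewrite -gtz0_ge1 normr_gt0 subr_eq0 eq_sym.
Qed.

Lemma hat_continuous j : continuous (hat j).
Proof.
move=> x; have c : {for x, continuous (fun x : R => 1 - `|N%:R * x - j%:R|)}.
  apply: cvgB; first exact: cvg_cst.
  apply: (@cvg_norm _ R); apply: cvgB; last exact: cvg_cst.
  by apply: cvgM; [exact: cvg_cst|exact: cvg_id].
exact: (@continuous_max _ _ (cst 0) _ x (cvg_cst _) c).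
Qed.

Lemma cell_exists x : x \in `]0, 1[ -> exists2 k, (k < N)%N &
  node k <= x < node k.+1.
Proof.
rewrite in_itv/= => /andP[x0 x1].
have Nx0 : 0 <= N%:R * x by rewrite mulr_ge0// ltW.
have /andP[h1 h2] := truncn_itv Nx0.
exists (Num.truncn (N%:R * x)).
  rewrite -(ltr_nat R); apply: le_lt_trans h1 _.
  by rewrite -[ltRHS]mulr1 ltr_pM2l.
by rewrite /node ler_pdivrMr// ltr_pdivlMr// (mulrC x) h1.
Qed.

Lemma Vh_continuous v : Vh N v -> continuous v. Proof. by case. Qed.

Lemma Vh_out v x : Vh N v -> x \notin `]0, 1[ -> v x = 0.
Proof. by case=> _ + _; apply. Qed.

Lemma Vh_node0 v : Vh N v -> v (node 0) = 0.
Proof. by move=> Hv; apply: Vh_out => //; rewrite node0 in_itv/= ltxx. Qed.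

Lemma Vh_nodeN v : Vh N v -> v (node N) = 0.
Proof.
move=> Hv; apply: Vh_out => //.
by rewrite nodeN in_itv/= ltxx andbF.
Qed.

Lemma Vh_scale a v : Vh N v -> Vh N (fun x => a * v x).
Proof.
case=> cv v0 va; split=> [x|x x01|j jN].
- by apply: cvgM; [exact: cvg_cst|exact: cv].
- by rewrite v0// mulr0.
- have [s [t st]] := va _ jN; exists (a * s), (a * t) => x xj.
  by rewrite st//; ring.
Qed.

Lemma VhD u v : Vh N u -> Vh N v -> Vh N (fun x => u x + v x).
Proof.
case=> cu u0 ua [cv v0 va]; split=> [x|x x01|j jN].
- by apply: cvgD; [exact: cu|exact: cv].
- by rewrite v0// u0// addr0.
- have [s [t st]] := va _ jN; have [s' [t' st']] := ua _ jN.
  by exists (s + s'), (t + t') => x xj; rewrite st// st'//; ring.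
Qed.

Lemma Vh0 : Vh N (fun=> 0 : R).
Proof.
split=> [x|//|j jN]; first exact: cvg_cst.
by exists 0, 0 => x _; rewrite mul0r addr0.
Qed.

Lemma Vh_sum I (s : seq I) (F : I -> R -> R) :
  (forall i, Vh N (F i)) -> Vh N (fun x => \sum_(i <- s) F i x).
Proof.
move=> HF; elim: s => [|i s IH].
  by under eq_fun do rewrite big_nil; exact: Vh0.
by under eq_fun do rewrite big_cons; exact: VhD.
Qed.

Lemma hat_Vh j : (0 < j)%N -> (j < N)%N -> Vh N (hat j).
Proof.
move=> j0 jN; split=> [|x|k kN]; first exact: hat_continuous.
  rewrite in_itv/= negb_and -!leNgt => x01.
  rewrite /hat max_l// subr_le0 ler_normr.
  have j1 : 1 <= j%:R :> R by rewrite ler1n.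
  have jN1 : j%:R + 1 <= N%:R :> R by rewrite natr1 ler_nat.
  case/orP: x01 => [x0|x1].
    by have := mulr_ge0_le0 (ltW NR) x0; move=> ?; apply/orP; right; lra.
  have : N%:R <= N%:R * x by rewrite -[leLHS]mulr1 ler_pM2l.
  by move=> ?; apply/orP; left; lra.
have cell x : x \in `[k%:R / N%:R, k.+1%:R / N%:R] ->
    k%:R <= N%:R * x /\ N%:R * x <= k%:R + 1.
  by rewrite in_itv/= ler_pdivrMr// ler_pdivlMr// mulrC natr1 => /andP[].
have [kj|jk|kj] := ltngtP k j; last subst k.
- have [kj'|] := leqP k.+2 j.
    exists 0, 0 => x /cell[x1 x2]; rewrite /hat max_l ?mul0r ?addr0// subr_le0.
    have : k%:R + 2 <= j%:R :> R by rewrite -natrD ler_nat addn2.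
    by rewrite ler_normr => ?; apply/orP; right; lra.
  rewrite ltnS => jk; have {jk kj} jE : j = k.+1 by apply/eqP; rewrite eqn_leq jk.
  exists N%:R, (- k%:R) => x /cell[x1 x2]; rewrite /hat jE -natr1.
  by rewrite ler0_norm; [rewrite max_r; lra|lra].
- exists 0, 0 => x /cell[x1 x2]; rewrite /hat max_l ?mul0r ?addr0// subr_le0.
  have : j%:R + 1 <= k%:R :> R by rewrite natr1 ler_nat.
  by rewrite ler_normr => ?; apply/orP; left; lra.
- exists (- N%:R), (j%:R + 1) => x /cell[x1 x2].
  by rewrite /hat ger0_norm; [rewrite max_r; lra|lra].
Qed.

Lemma Vh_cell v k x : Vh N v -> (k < N)%N -> node k <= x <= node k.+1 ->
  v x = v (node k) + N%:R * (v (node k.+1) - v (node k)) * (x - node k).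
Proof.
case=> _ _ va kN xk; have [a [b ab]] := va _ kN.
have kk : node k <= node k.+1.
  by rewrite ler_pM2r ?invr_gt0// ler_nat.
have h : node k.+1 = node k + N%:R^-1 by rewrite /node -natr1 mulrDl mul1r.
rewrite (ab x) ?in_itv//= (ab (node k)) ?in_itv/= ?lexx ?kk//.
rewrite (ab (node k.+1)) ?in_itv/= ?lexx ?kk//.
by rewrite h; field; rewrite gt_eqF.
Qed.

(** On each cell such a function is affine and vanishes at both ends. *)
Lemma Vh_nodal_eq0 v : Vh N v ->
  (forall j, (0 < j)%N -> (j < N)%N -> v (node j) = 0) -> v = fun=> 0.
Proof.
move=> Hv v0.
have v0' j : (j <= N)%N -> v (node j) = 0.
  case: j => [_|j]; first exact: Vh_node0.
  rewrite leq_eqVlt => /orP[/eqP ->|jN]; first exact: Vh_nodeN.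
  exact: v0.
apply/funext => x; have [x01|x01] := boolP (x \in `]0, 1[); last exact: Vh_out.
have [k kN /andP[x1 x2]] := cell_exists x01.
rewrite (Vh_cell Hv kN); last by rewrite x1 ltW.
by rewrite !v0' ?(ltnW kN)//; ring.
Qed.

Notation n := N.-1.
Definition phi (i : 'I_n) := hat i.+1.

Lemma phi_Vh i : Vh N (phi i).
Proof. by apply: hat_Vh => //; have := ltn_ord i; rewrite -ltnS (prednK N_gt0). Qed.

Definition nodal (U : 'I_n -> R) x : R := \sum_(i < n) U i * phi i x.

Lemma nodal_Vh U : Vh N (nodal U).
Proof. by apply: Vh_sum => i; apply: Vh_scale; exact: phi_Vh. Qed.

Lemma nodal_node U (i : 'I_n) : nodal U (node i.+1) = U i.
Proof.
rewrite /nodal (bigD1 i)//= /phi hat_node eqxx mulr1 big1 ?addr0// => j ji.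
by rewrite hat_node eqSS val_eqE (negbTE ji) mulr0.
Qed.

Lemma Vh_nodal v : Vh N v -> v = nodal (fun i => v (node i.+1)).
Proof.
move=> Hv; set w := nodal _.
have Hw : Vh N (fun x => v x + -1 * w x).
  by apply: VhD => //; apply: Vh_scale; exact: nodal_Vh.
have E : (fun x => v x + -1 * w x) = fun=> 0.
  apply: Vh_nodal_eq0 Hw _ => -[//|j] _ jN.
  have jn : (j < n)%N by rewrite -ltnS prednK.
  by rewrite /w -[j]/(val (Ordinal jn)) nodal_node mulN1r subrr.
apply/funext => x; apply/eqP; rewrite -subr_eq0 -mulN1r; apply/eqP.
exact: (congr1 (fun f => f x) E).
Qed.

End finite_elements.

(** * Bounded functions and null sets on (0,1) *)
Section bounded_functions.
Context (R : realType).
Notation mu := (leb01 R).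

Lemma leb01_setT : leb01 R setT = 1%E.
Proof.
by rewrite /leb01/= /mrestr/= setTI lebesgue_measure_itv/= lte01 oppr0 adde0.
Qed.

Definition bounded_meas (f : R -> R) : Prop :=
  measurable_fun setT f /\ exists M, forall x, `|f x| <= M.

Lemma bounded_meas_sqint f : bounded_meas f -> sqint mu f.
Proof.
move=> [mf [M fM]]; apply/sqintP; split=> //.
apply: (@le_lt_trans _ _ (\int[mu]_x (M ^+ 2)%:E)%E).
  apply: le_integral_ge0 => x; first by rewrite lee_fin sqr_ge0.
  rewrite lee_fin -(real_normK (num_real (f x))) lerXn2r ?nnegrE//.
  exact: le_trans (fM x).
by rewrite integral_cst// leb01_setT mule1 ltry.
Qed.

Lemma bounded_measM f g : bounded_meas f -> bounded_meas g ->
  bounded_meas (fun x => f x * g x).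
Proof.
move=> [mf [M fM]] [mg [M' gM]]; split; first exact: measurable_funM.
by exists (M * M') => x; rewrite normrM ler_pM.
Qed.

Lemma bounded_meas_scale a f : bounded_meas f -> bounded_meas (fun x => a * f x).
Proof.
move=> [mf [M fM]]; split; first exact: measurable_funM.
by exists (`|a| * M) => x; rewrite normrM ler_wpM2l.
Qed.

Lemma bounded_meas_sum I (s : seq I) (F : I -> R -> R) :
  (forall i, bounded_meas (F i)) -> bounded_meas (fun x => \sum_(i <- s) F i x).
Proof.
move=> HF; split; first by apply: measurable_sum => i; have [] := HF i.
elim: s => [|i s [M HM]]; first by exists 0 => x; rewrite big_nil normr0.
have [_ [M' HM']] := HF i; exists (M' + M) => x.
by rewrite big_cons (le_trans (ler_normD _ _))// lerD.
Qed.

Lemma bounded_meas_indic A : measurable A -> bounded_meas \1_A.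
Proof.
move=> mA; split; first exact: measurable_indic.
by exists 1 => x; rewrite indicE; case: (_ \in _); rewrite ?normr1 ?normr0.
Qed.

(** Used for [derive1], whose values at the mesh points are arbitrary. *)
Lemma measurable_off_countable (F : set R) (f g : R -> R) :
  countable F -> measurable_fun setT g -> (forall x, ~ F x -> f x = g x) ->
  measurable_fun setT f.
Proof.
move=> cF mg fg _ B mB; rewrite setTI.
have -> : f @^-1` B = (g @^-1` B `&` ~` F) `|` (f @^-1` B `&` F).
  apply/seteqP; split=> x /=.
    by move=> fB; have [Fx|nFx] := pselect (F x); [right|left; rewrite -fg].
  by case=> -[] // ? nFx; rewrite fg.
apply: measurableU.
  apply: measurableI; first by rewrite -[X in measurable X]setTI; exact: mg.
  apply: measurableC.
  exact: (@countable_measurable _ _ _ (fun t => measurable_set1 t)).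
apply: (@countable_measurable _ _ _ (fun t => measurable_set1 t)).
by apply: sub_countable cF; exact: subset_card_le.
Qed.

Lemma leb01_countable (F : set R) : countable F -> leb01 R F = 0%E.
Proof.
move=> cF; rewrite /leb01/= /mrestr/=; apply: countable_lebesgue_measure0.
by apply: sub_countable cF; apply: subset_card_le.
Qed.

End bounded_functions.

(** * Derivatives and cubes of finite element functions *)
Section forms.
Context (R : realType) (N : nat).
Hypothesis N_gt0 : (0 < N)%N.
Notation mu := (leb01 R).
Notation n := N.-1.
Implicit Types (u v : R -> R).
Local Notation node := (@node R N).
Local Notation phi := (@phi R N).

Lemma hat_bounded j : bounded_meas (hat N j : R -> R).
Proof.
split; first by apply: continuous_measurable_fun; exact: hat_continuous.
by exists 1 => x; rewrite ger0_norm ?hat_ge0// hat_le1.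
Qed.

Lemma nodal_bounded (U : 'I_n -> R) : bounded_meas (nodal U : R -> R).
Proof. by apply: bounded_meas_sum => i; apply/bounded_meas_scale/hat_bounded. Qed.

Lemma Vh_bounded v : Vh N v -> bounded_meas v.
Proof. by move=> /(Vh_nodal N_gt0) ->; exact: nodal_bounded. Qed.

Lemma Vh_sqint v : Vh N v -> sqint mu v.
Proof. by move=> /Vh_bounded; exact: bounded_meas_sqint. Qed.

(** The almost everywhere derivative of a member of [V_h], read off its nodal
    values: it is linear in [v] and measurable for every [v]. *)
Definition slope v (x : R) : R :=
  \sum_(k < N) N%:R * (v (node k.+1) - v (node k)) *
    \1_(`]node k, node k.+1[%classic) x.

Lemma slope_bounded v : bounded_meas (slope v).
Proof.
apply: bounded_meas_sum => k; apply: bounded_meas_scale.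
exact: bounded_meas_indic.
Qed.

Lemma slope_sqint v : sqint mu (slope v).
Proof. exact/bounded_meas_sqint/slope_bounded. Qed.

Lemma slope_nodal (U : 'I_n -> R) :
  slope (nodal U) = fun x => \sum_(i < n) U i * slope (phi i) x.
Proof.
apply/funext => x; rewrite /slope.
under [RHS]eq_bigr do rewrite mulr_sumr.
rewrite exchange_big/=; apply: eq_bigr => k _.
rewrite /nodal -sumrB mulr_sumr mulr_suml; apply: eq_bigr => i _; ring.
Qed.

Definition nodes : set R := range node.

Lemma nodes_countable : countable nodes.
Proof. by apply: card_le_trans (card_image_le _ _) _; exact: card_lexx. Qed.


Lemma slope_cell v k x : (k < N)%N -> node k < x < node k.+1 ->
  slope v x = N%:R * (v (node k.+1) - v (node k)).
Proof.
move=> kN /andP[x1 x2]; rewrite /slope (bigD1 (Ordinal kN))//= big1 ?addr0.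
  by rewrite indicE mem_set ?mulr1//= in_itv/= x1.
move=> i ik; rewrite indicE memNset ?mulr0//= in_itv/= => /andP[h1 h2].
move: ik; rewrite -val_eqE/= neq_ltn => /orP[ik|ki].
  have : node i.+1 <= node k by rewrite (node_le R N_gt0).
  by move=> /(lt_le_trans h2)/(lt_trans x1); rewrite ltxx.
have : node k.+1 <= node i by rewrite (node_le R N_gt0).
by move=> /(lt_le_trans x2)/(lt_trans h1); rewrite ltxx.
Qed.

Lemma derive1_slope v x : Vh N v -> ~ nodes x -> derive1 v x = slope v x.
Proof.
move=> Hv xF.
have xn k : x != node k by apply: contra_notN xF => /eqP ->; exists k.
have [x01|x01] := boolP (x \in `]0, 1[).
  have [k kN /andP[x1 x2]] := cell_exists N_gt0 x01.
  have {}x1 : node k < x by rewrite lt_neqAle x1 eq_sym xn.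
  rewrite (slope_cell _ kN) ?x1//.
  set a := N%:R * _.
  have E : \forall y \near x, v (node k) + a * (y - node k) = v y.
    have : \forall y \near x, y \in `]node k, node k.+1[.
      by apply: near_in_itvoo; rewrite in_itv/= x1.
    apply: filterS => y; rewrite in_itv/= => /andP[y1 y2].
    by rewrite [RHS](Vh_cell N_gt0 Hv kN) ?(ltW y1) ?(ltW y2).
  rewrite derive1E -(near_eq_derive _ E).
  have -> : (fun y : R => v (node k) + a * (y - node k)) =
    (cst (v (node k)) + (a *: (id - cst (node k)))) by [].
  rewrite deriveD// deriveZ// deriveB// !derive_cst derive_id.
  by rewrite subr0 add0r /GRing.scale/= mulr1.
have -> : slope v x = 0.
  rewrite /slope big1// => k _; rewrite indicE memNset ?mulr0//= in_itv/=.
  move=> /andP[h1 h2]; move/negP: x01; apply; rewrite in_itv/=; apply/andP; split.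
    by apply: le_lt_trans h1; rewrite -(node0 R N) (node_le R N_gt0).
  by apply: lt_le_trans h2 _; rewrite -(nodeN R N_gt0) (node_le R N_gt0).
have E : \forall y \near x, 0 = v y.
  have : x < 0 \/ 1 < x.
    move: x01; rewrite in_itv/= negb_and -!leNgt => /orP[].
      by rewrite le_eqVlt -(node0 R N) (negbTE (xn _))/=; left.
    by rewrite le_eqVlt eq_sym -(nodeN R N_gt0) (negbTE (xn _))/=; right.
  case=> h.
    have : \forall y \near x, y < 0 by exact: lt_nbhsl.
    apply: filterS => y y0; rewrite (Vh_out Hv)//.
    by rewrite in_itv/= ltNge (ltW y0).
  have : \forall y \near x, 1 < y by exact: lt_nbhsr.
  apply: filterS => y y0; rewrite (Vh_out Hv)//.
  by rewrite in_itv/= negb_and -!leNgt (ltW y0) orbT.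
by rewrite derive1E -(near_eq_derive _ E) derive_cst.
Qed.

Lemma ip_derive1 u v : Vh N u -> Vh N v ->
  ip (derive1 u) (derive1 v) = dot mu (slope u) (slope v).
Proof.
move=> Hu Hv; rewrite /ip /dot /Rintegral; congr fine.
have mD (w : R -> R) : Vh N w ->
    measurable_fun (setT : set R) (derive1 w : R -> R).
  move=> Hw.
  apply: (@measurable_off_countable R nodes (derive1 w) (slope w)) => //.
  - exact: nodes_countable.
  - by have [] := slope_bounded w.
  - by move=> x xF; exact: derive1_slope.
apply: ae_eq_integral => //.
- by apply/measurable_EFinP/measurable_funM; exact: mD.
- apply/measurable_EFinP/measurable_funM; first exact: (slope_bounded u).1.
  exact: (slope_bounded v).1.
- exists nodes; split.
  + by apply: countable_measurable nodes_countable => t; exact: measurable_set1.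
  + exact: leb01_countable nodes_countable.
  + move=> x /=; apply: contra_notP => xF _; by rewrite !derive1_slope.
Qed.

Lemma dot_nodal (U : 'I_n -> R) g h : bounded_meas g -> sqint mu h ->
  dot mu (fun x => nodal U x * g x) h =
  \sum_(i < n) U i * dot mu (fun x => phi i x * g x) h.
Proof.
move=> bg sh.
have sphi (i : 'I_n) : sqint mu (fun x => phi i x * g x).
  by apply/bounded_meas_sqint/bounded_measM => //; exact: hat_bounded.
have -> : (fun x => nodal U x * g x) =
    fun x => \sum_(i < n) U i * (phi i x * g x).
  by apply/funext => x; rewrite /nodal mulr_suml; apply: eq_bigr => i _; ring.
rewrite dot_suml//; last by move=> i; exact: sqint_scale.
by apply: eq_bigr => i _; rewrite dotZl.
Qed.

Definition cubic (i j k : 'I_n) h := dot mu (fun x => phi i x * (phi j x * phi k x)) h.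

(** The cubic term of the scheme is a polynomial in the nodal values, which is how
    its measurability in the random parameter is seen. *)
Lemma dot_nodal_cube (U : 'I_n -> R) h : sqint mu h ->
  dot mu (fun x => nodal U x ^+ 3) h =
  \sum_(i < n) U i * \sum_(j < n) U j * \sum_(k < n) U k * cubic i j k h.
Proof.
move=> sh; have bU := nodal_bounded U.
have bphi (i : 'I_n) : bounded_meas (phi i) := hat_bounded i.+1.
have -> : (fun x => nodal U x ^+ 3) = fun x => nodal U x * (nodal U x * nodal U x).
  by apply/funext => x; ring.
rewrite dot_nodal//; last exact: bounded_measM.
apply: eq_bigr => i _; congr (_ * _).
have -> : (fun x => phi i x * (nodal U x * nodal U x)) =
    fun x => nodal U x * (phi i x * nodal U x) by apply/funext => x; ring.
rewrite dot_nodal//; last exact: bounded_measM.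
apply: eq_bigr => j _; congr (_ * _).
have -> : (fun x => phi j x * (phi i x * nodal U x)) =
    fun x => nodal U x * (phi i x * phi j x) by apply/funext => x; ring.
rewrite dot_nodal//; last exact: bounded_measM.
apply: eq_bigr => k _; congr (_ * _).
by rewrite /cubic; congr dot; apply/funext => x; ring.
Qed.

End forms.

(** * The bilinear form of the implicit step *)
Section riesz.
Context (R : realType) (N : nat).
Hypothesis N_gt0 : (0 < N)%N.
Notation mu := (leb01 R).
Notation n := N.-1.
Implicit Types (u v : R -> R).
Local Notation node := (@node R N).
Local Notation phi := (@phi R N).
Local Notation slope := (slope N).

(** A continuous function that does not vanish at a point of (0,1) does not vanish
    on a ball around it, which has positive measure. *)
Lemma Vh_dot_eq0 v : Vh N v -> dot mu v v = 0 -> v = fun=> 0.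
Proof.
move=> Hv v0; have Hs := Vh_sqint N_gt0 Hv.
have [mv _] := Vh_bounded N_gt0 Hv.
have cv := Vh_continuous Hv.
have I0 : (\int[mu]_x `|(v x * v x)%:E| = 0)%E.
  transitivity (\int[mu]_x (v x * v x)%:E)%E; last by rewrite dotE// v0.
  by apply: eq_integral => x _; rewrite /= ger0_norm// -expr2 sqr_ge0.
have mvv : measurable_fun setT (fun x => (v x * v x)%:E).
  by apply/measurable_EFinP; exact: measurable_funM.
have [Z [mZ Z0 vZ]] := (ae_eq_integral_abs mu measurableT mvv).1 I0.
apply/funext => x; have [x01|x01] := boolP (x \in `]0, 1[); last exact: Vh_out Hv _.
apply/eqP/negPn/negP => vx0.
have : \forall y \near x, v y != 0.
  have /cvgr_neq0 : v y @[y --> x] --> v x by exact: cv.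
  exact.
have : \forall y \near x, y \in `]0, 1[ by exact: near_in_itvoo.
move=> /filterI/[apply] /nbhs_ballP[e /= e0 xe].
have : (mu (ball x e) <= mu Z)%E.
  apply: le_measure; rewrite ?inE//; first exact: measurable_ball.
  move=> y /xe[_ vy0]; apply: vZ => /= /(_ I) [] /eqP.
  by rewrite mulf_eq0 orbb (negbTE vy0).
rewrite Z0 leNgt => /negP; apply.
rewrite /leb01/= /mrestr/= (_ : _ `&` _ = ball x e).
  by rewrite lebesgue_measure_ball ?ltW// lte_fin mulrn_wgt0.
by apply/seteqP; split=> [y []//|y ye]; split=> //; exact: (xe y ye).1.
Qed.

(** The inner product for [theta = 0], the form of the implicit Euler operator for
    [theta = tau]. *)
Definition form (theta : R) u v : R :=
  dot mu u v + theta * dot mu (slope u) (slope v).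

Lemma formC theta u v : form theta u v = form theta v u.
Proof. by rewrite /form dotC [X in _ + _ * X]dotC. Qed.

Lemma form_nodal theta (U : 'I_n -> R) v : Vh N v ->
  form theta (nodal U) v = \sum_(i < n) U i * form theta (phi i) v.
Proof.
move=> Hv; rewrite /form slope_nodal /nodal.
have sv := Vh_sqint N_gt0 Hv.
have sphi (i : 'I_n) := Vh_sqint N_gt0 (phi_Vh R N_gt0 i).
rewrite dot_suml//; last by move=> i; exact: sqint_scale.
rewrite dot_suml; [|by move=> i; exact/sqint_scale/slope_sqint|exact: slope_sqint].
rewrite mulr_sumr -big_split/=; apply: eq_bigr => i _.
by rewrite !dotZl//; try exact: slope_sqint; ring.
Qed.

(** The matrix of the form in the hat functions is invertible since the form is
    definite, and its inverse yields functions that represent the nodal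
    values.  For [theta = 0] this expresses nodal values through inner
    products; for [theta = tau] it solves the implicit step. *)
Lemma riesz theta : 0 <= theta -> exists psi : 'I_n -> R -> R,
  (forall i, Vh N (psi i)) /\
  forall v, Vh N v -> forall i, form theta v (psi i) = v (node i.+1).
Proof.
move=> theta0.
pose A : 'M[R]_n := \matrix_(i, j) form theta (phi i) (phi j).
have formE (U V : 'I_n -> R) : form theta (nodal U) (nodal V) =
    \sum_(i < n) U i * \sum_(j < n) A i j * V j.
  rewrite form_nodal; last exact: nodal_Vh.
  apply: eq_bigr => i _; rewrite formC form_nodal; last exact: phi_Vh.
  by congr (_ * _); apply: eq_bigr => j _; rewrite mxE formC mulrC.
have Aunit : A \in unitmx.
  rewrite -row_free_unit; apply: inj_row_free => x xA.
  pose U i := x 0 i.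
  have f0 : form theta (nodal U) (nodal U) = 0.
    rewrite formE; under eq_bigr do rewrite mulr_sumr.
    rewrite exchange_big/= big1// => j _.
    have /rowP/(_ j) := xA; rewrite !mxE => xAj.
    under eq_bigr do rewrite mulrA.
    by rewrite -mulr_suml xAj mul0r.
  have d0 : dot mu (nodal U) (nodal U) = 0.
    have := dot_ge0 mu (nodal U).
    have := mulr_ge0 theta0 (dot_ge0 mu (slope (nodal U))).
    by move: f0; rewrite /form; lra.
  have U0 := Vh_dot_eq0 (nodal_Vh N_gt0 U) d0.
  by apply/rowP => i; rewrite mxE -[LHS]/(U i) -(nodal_node N_gt0 U i) U0.
exists (fun i => nodal (fun j => invmx A j i)); split=> [i|v Hv i].
  exact: nodal_Vh.
rewrite {1}(Vh_nodal N_gt0 Hv) formE.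
have AV k : \sum_(j < n) A k j * invmx A j i = (k == i)%:R.
  by have /matrixP/(_ k i) := mulmxV Aunit; rewrite !mxE.
under eq_bigr do rewrite AV.
by rewrite (bigD1 i)//= eqxx mulr1 big1 ?addr0// => j /negbTE ->; rewrite mulr0.
Qed.

Lemma node_le_norm : exists2 C : R, 0 <= C & forall v, Vh N v ->
  forall i : 'I_n, v (node i.+1) ^+ 2 <= C * dot mu v v.
Proof.
have [psi [Hpsi rep]] := riesz (lexx 0).
exists (\sum_(i < n) dot mu (psi i) (psi i)).
  by apply: sumr_ge0 => i _; exact: dot_ge0.
move=> v Hv i; rewrite -(rep _ Hv) /form mul0r addr0.
apply: le_trans (dot_CS (Vh_sqint N_gt0 Hv) (Vh_sqint N_gt0 (Hpsi i))) _.
rewrite mulrC ler_wpM2r ?dot_ge0// (bigD1 i)//= lerDl.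
by apply: sumr_ge0 => j _; exact: dot_ge0.
Qed.

(** The coordinates of [u] and [v] in the basis of hat functions are bounded by
    their norms ([node_le_norm]): this plays the role of the inverse inequality
    between the norms of [v'] and [v] on [V_h]. *)
Lemma form_bounded theta : exists2 K : R, 0 < K & forall u v, Vh N u -> Vh N v ->
  `|form theta u v| <= K * L2norm u * L2norm v.
Proof.
have [C C0 nodeC] := node_le_norm.
pose S := \sum_(i < n) \sum_(j < n) `|form theta (phi i) (phi j)|.
have S0 : 0 <= S by apply: sumr_ge0 => i _; apply: sumr_ge0.
exists (1 + C * S); first by rewrite ltr_pwDl// mulr_ge0.
have nodeN w (i : 'I_n) : Vh N w -> `|w (node i.+1)| <= Num.sqrt C * L2norm w.
  by move=> Hw; rewrite -sqrtrM// -sqrtr_sqr ler_wsqrtr//; exact: nodeC.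
move=> u v Hu Hv.
rewrite {1}(Vh_nodal N_gt0 Hu) form_nodal//.
apply: (@le_trans _ _ (C * S * L2norm u * L2norm v)); last first.
  by rewrite !ler_wpM2r ?sqrtr_ge0// lerDr.
apply: le_trans (ler_norm_sum _ _ _) _.
rewrite /S mulr_sumr !mulr_suml; apply: ler_sum => i _.
rewrite formC {1}(Vh_nodal N_gt0 Hv) form_nodal; last exact: phi_Vh.
rewrite normrM; apply: le_trans (ler_wpM2l (normr_ge0 _) (ler_norm_sum _ _ _)) _.
rewrite !mulr_sumr !mulr_suml; apply: ler_sum => j _.
rewrite normrM formC -[C]sqr_sqrtr// mulrA.
have := ler_pM (normr_ge0 _) (normr_ge0 _) (nodeN u i Hu) (nodeN v j Hv).
move=> /(ler_wpM2r (normr_ge0 (form theta (phi i) (phi j)))) h.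
by apply: le_trans h _; rewrite le_eqVlt; apply/orP; left; apply/eqP; ring.
Qed.

End riesz.

(** * The energy inequality *)
Section energy_inequality.
Context (R : realType) (N : nat).
Hypothesis N_gt0 : (0 < N)%N.
Notation mu := (leb01 R).
Notation n := N.-1.
Implicit Types (u v : R -> R).
Local Notation node := (@node R N).
Local Notation phi := (@phi R N).
Variable tau : R.
Hypothesis tau_gt0 : 0 < tau.

Lemma Vh_L2 v : Vh N v -> exists f : L2 R, (f : R -> R) = v.
Proof. by move=> Hv; exists (Lfun_Sub (lee1n 2) (Vh_sqint N_gt0 Hv)). Qed.

(** Cauchy-Schwarz for [v^2] and [1]; the interval has length one. *)
Lemma Vh_pow4 v : Vh N v -> ip v v ^+ 2 <= ip (fun x => v x ^+ 3) v.
Proof.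
move=> Hv; have bv := Vh_bounded N_gt0 Hv.
have b1 : bounded_meas (fun=> 1 : R).
  by split; [exact: measurable_cst|exists 1 => x; rewrite normr1].
have bvv := bounded_measM bv bv.
have := dot_CS (bounded_meas_sqint bvv) (bounded_meas_sqint b1).
have -> : dot mu (fun=> 1) (fun=> 1) = 1.
  rewrite /dot (@Rintegral_cst _ _ _ mu setT) //.
  by rewrite leb01_setT/= !mulr1.
rewrite mulr1; congr (_ ^+ _ <= _).
  by apply: eq_Rintegral => x _; rewrite mulr1.
by apply: eq_Rintegral => x _; ring.
Qed.

(** The tested scheme bounds [tau |u|^4 - |u|^2 - z] by [- form tau u' u], hence
    by [K |u'| |u|], and [0 <= (K |u'| - |u|)^2] separates the two norms. *)
Lemma scheme_energy K : 0 < K ->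
  (forall u v, Vh N u -> Vh N v -> `|form N tau u v| <= K * L2norm u * L2norm v) ->
  forall u u' z, Vh N u -> Vh N u' ->
  ip (u' - u) u = - tau * ip (derive1 u') (derive1 u)
    - tau * ip (fun x => u x ^+ 3) u + z ->
  2 * tau * ip u u ^+ 2 - 3 * ip u u - 2 * z <= K ^+ 2 * ip u' u'.
Proof.
move=> K0 HK u u' z Hu Hu' E.
have sub : ip (u' - u) u = ip u' u - ip u u.
  by rewrite !ipE; apply: dotBl; exact: (Vh_sqint N_gt0).
have F : form N tau u' u = ip u u - tau * ip (fun x => u x ^+ 3) u + z.
  rewrite /form -!ip_derive1// -ipE.
  by move: E; rewrite sub; lra.
have h4 := Vh_pow4 Hu.
have := HK _ _ Hu' Hu; rewrite ler_norml => /andP[h _].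
rewrite -!L2norm_sq in F h4 *.
set x := L2norm u in F h4 h *; set y := L2norm u' in h *.
have h5 := ler_wpM2l (ltW tau_gt0) h4.
have := sqr_ge0 (K * y - x).
rewrite F in h.
by nra.
Qed.

Lemma growth_poly K : 0 < K -> exists2 c : R, 0 <= c & forall x : R,
  K ^+ 2 * (2 * x - c) <= 2 * tau * x ^+ 2 - 3 * x.
Proof.
(* [q] is the point where the parabola has slope [2 K^2]. *)
move=> K0; pose q := (3 + 2 * K ^+ 2) / (4 * tau).
exists (2 * tau * q ^+ 2 / K ^+ 2) => [|y].
  by rewrite divr_ge0 ?sqr_ge0// mulr_ge0 ?sqr_ge0// mulr_ge0// ltW.
have K20 : K ^+ 2 != 0 by rewrite expf_neq0// gt_eqF.
have -> : K ^+ 2 * (2 * y - 2 * tau * q ^+ 2 / K ^+ 2) =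
  2 * K ^+ 2 * y - 2 * tau * q ^+ 2 by field; rewrite gt_eqF.
have tq : 4 * tau * q = 3 + 2 * K ^+ 2 by rewrite /q; field; rewrite gt_eqF.
have := mulr_ge0 (ltW tau_gt0) (sqr_ge0 (y - q)).
have : 4 * tau * q * y = (3 + 2 * K ^+ 2) * y by rewrite tq.
by lra.
Qed.

End energy_inequality.

(** * Growth of the mean square along the scheme *)
Section scheme.
Context (R : realType) (N : nat).
Hypothesis N_gt0 : (0 < N)%N.
Notation mu := (leb01 R).
Notation m := N.-1.
Local Notation node := (@node R N).
Local Notation phi := (@phi R N).
Variable tau : R.
Hypothesis tau_gt0 : 0 < tau.
Context d (Omega : measurableType d) (P : probability Omega R).
Variables (e : nat -> L2 R) (gamma : nat -> R).
Variables (beta : nat -> R -> Omega -> R) (W : R -> Omega -> L2 R).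
Variable u : nat -> Omega -> R -> R.
Hypothesis HW : Q_wiener P e gamma beta W.
Hypothesis u_Vh : forall k w, Vh N (u k w).
Hypothesis u_meas : forall k, L2_measurable (u k).
Hypothesis u0_indep :
  independent P (L2_sigma [set 0%N] u) (L2_sigma [set t : R | 0 <= t] W).
Hypothesis u_scheme : fem_euler_scheme P N tau W u.

Definition known (k : nat) : set (set Omega) :=
  history P (brownian_step beta tau) (L2_generators [set 0%N] u)
    (L2_generators [set t : R | 0 <= t] W) k.

Let steps_sqint j k : sqint P (brownian_step beta tau j k).
Proof. by have [] := brownian_step_centred tau_gt0 HW j k. Qed.

Let steps_mean0 j k : (\int[P]_w (brownian_step beta tau j k w)%:E = 0)%E.
Proof. by have [] := brownian_step_centred tau_gt0 HW j k. Qed.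

Let approx := wiener_step_approx tau_gt0 HW.
Let wmeas := wiener_step_measurable tau_gt0 HW.

Lemma known_noise_centred k f : centred_on P <<s known k >> (wiener_step W tau k f).
Proof.
apply: (history_centred steps_sqint steps_mean0 _ approx wmeas).
- exact: (brownian_step_rect tau_gt0 HW).
- exact: L2_generators_measurable.
- by apply: L2_generators_measurable => t t0; exact: (wiener_measurable HW).
- exact: u0_indep.
- exact: (wiener_step_sigma tau_gt0).
Qed.

Lemma wiener_step_sqint k f : sqint P (wiener_step W tau k f).
Proof. exact: (noise_sqint steps_sqint approx wmeas). Qed.

Definition known_fun k (X : Omega -> R) :=
  measurable_fun (setT : set (g_sigma_algebraType (known k))) X.

Lemma known_noise k l f : (k < l)%N -> known_fun l (wiener_step W tau k f).
Proof.
move=> kl _ B mB; rewrite setTI.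
apply: (history_noise steps_sqint approx wmeas) => //.
exact: (wiener_step_sigma tau_gt0).
Qed.

Lemma known_measurable k X : known_fun k X -> measurable_fun setT X.
Proof.
move=> HX _ B mB; have := HX measurableT B mB; rewrite !setTI.
apply: sub_sigma_measurable; apply: history_measurable.
- exact: L2_generators_measurable.
- by apply: L2_generators_measurable => t t0; exact: (wiener_measurable HW).
Qed.

Lemma known_initial k (f : L2 R) : known_fun k (fun w => ip (u 0%N w) f).
Proof.
move=> _ B mB; rewrite setTI; apply: history_initial.
exact: (@sigma_generatedP _ _ _ _ [set p : nat * L2 R | [set 0%N] p.1]
    (fun p w => ip (u p.1 w) p.2) (0%N, f) B erefl mB).
Qed.

(** Testing with the representers of the nodal values for the form of the implicit
    step solves for [u^{k+1}]: its nodal values are polynomials in those of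
    [u^k] plus the noise of step [k].  The scheme holds almost surely only, hence
    the known modification [X]. *)
Lemma nodal_known k l : (k <= l)%N -> forall i : 'I_m,
  exists2 X, known_fun l X & {ae P, forall w, u k w (node i.+1) = X w}.
Proof.
elim: k => [_|k IH kl] i.
  have [psi [psiV rep]] := riesz N_gt0 (lexx (0 : R)).
  have [f fE] := Vh_L2 N_gt0 (psiV i).
  exists (fun w => ip (u 0%N w) f); first exact: known_initial.
  apply: nearW => w; rewrite -(rep _ (u_Vh 0%N w)) /form mul0r addr0.
  by rewrite ipE fE.
have [psi [psiV rep]] := riesz N_gt0 (ltW tau_gt0).
have [f fE] := Vh_L2 N_gt0 (psiV i).
have [X0 HX0] := choice (fun j => let: ex_intro2 X a b := IH (ltnW kl) j in
  ex_intro (fun X => known_fun l X /\ {ae P, forall w, u k w (node j.+1) = X w})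
    X (conj a b)).
have spsi := Vh_sqint N_gt0 (psiV i).
pose X w := \sum_(j < m) X0 j w * dot mu (phi j) (psi i)
  - tau * (\sum_(i1 < m) X0 i1 w * \sum_(i2 < m) X0 i2 w *
      \sum_(i3 < m) X0 i3 w * cubic i1 i2 i3 (psi i))
  + Num.sqrt 2 * wiener_step W tau k f w.
have mX0 j : known_fun l (X0 j) by have [] := HX0 j.
exists X.
  apply: measurable_funD; last by apply: measurable_funM => //; exact: known_noise.
  apply: measurable_funB.
    by apply: measurable_sum => j; apply: measurable_funM; [exact: mX0|].
  apply: measurable_funM => //.
  apply: measurable_sum => i1; apply: measurable_funM; first exact: mX0.
  apply: measurable_sum => i2; apply: measurable_funM; first exact: mX0.
  by apply: measurable_sum => i3; apply: measurable_funM; [exact: mX0|].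
have aeX0 : {ae P, forall w, forall j : 'I_m, u k w (node j.+1) = X0 j w}.
  by apply: filter_forall => j; have [] := HX0 j.
apply: filterS2 aeX0 (u_scheme k) => w Xw /(_ _ (psiV i)) S.
rewrite -(rep _ (u_Vh k.+1 w)) /form -!ip_derive1// -ipE.
have uE : u k w = nodal (fun j => X0 j w).
  rewrite (Vh_nodal N_gt0 (u_Vh k w)); congr nodal; apply/funext => j; exact: Xw.
have sub : ip (u k.+1 w - u k w) (psi i) = ip (u k.+1 w) (psi i) - ip (u k w) (psi i).
  by rewrite !ipE; apply: dotBl => //; exact: (Vh_sqint N_gt0).
have -> : ip (u k.+1 w) (psi i) + tau * ip (derive1 (u k.+1 w)) (derive1 (psi i)) =
   ip (u k w) (psi i) - tau * ip (fun x => u k w x ^+ 3) (psi i) +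
   Num.sqrt 2 * wiener_step W tau k f w.
  move: S; rewrite sub -fE ip_subl /wiener_step; lra.
rewrite /X; congr (_ - _ * _ + _).
  rewrite uE ipE /nodal dot_suml//.
    by apply: eq_bigr => j _; rewrite dotZl//; exact: (Vh_sqint N_gt0 (phi_Vh R N_gt0 j)).
  by move=> j; exact: (sqint_scale _ (Vh_sqint N_gt0 (phi_Vh R N_gt0 j))).
by rewrite ipE uE dot_nodal_cube.
Qed.


Definition energy k w := ip (u k w) (u k w).
Definition coord k (i : 'I_m) w := u k w (node i.+1).

Lemma coord_measurable k i : measurable_fun setT (coord k i).
Proof.
have [psi [psiV rep]] := riesz N_gt0 (lexx (0 : R)).
have [f fE] := Vh_L2 N_gt0 (psiV i).
have -> : coord k i = fun w => ip (u k w) f.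
  by apply/funext => w; rewrite /coord -(rep _ (u_Vh k w)) /form mul0r addr0 ipE fE.
exact: u_meas.
Qed.

Let sphi (i : 'I_m) : sqint mu (phi i) := Vh_sqint N_gt0 (phi_Vh R N_gt0 i).

Lemma u_nodal k w : u k w = nodal (coord k ^~ w).
Proof. exact: Vh_nodal (u_Vh k w). Qed.

Lemma dot_u k w h : sqint mu h ->
  dot mu (u k w) h = \sum_(i < m) coord k i w * dot mu (phi i) h.
Proof.
move=> sh; rewrite {1}u_nodal /nodal dot_suml//.
  by apply: eq_bigr => i _; rewrite dotZl.
by move=> i; exact: sqint_scale.
Qed.

Lemma energy_measurable k : measurable_fun setT (energy k).
Proof.
have -> : energy k = fun w => \sum_(i < m) coord k i w *
    \sum_(j < m) coord k j w * dot mu (phi j) (phi i).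
  apply/funext => w; rewrite /energy ipE dot_u; last exact: (Vh_sqint N_gt0).
  by apply: eq_bigr => i _; rewrite dotC dot_u.
apply: measurable_sum => i; apply: measurable_funM; first exact: coord_measurable.
by apply: measurable_sum => j; apply: measurable_funM => //; exact: coord_measurable.
Qed.

Lemma energy_ge0 k w : 0 <= energy k w.
Proof. exact: dot_ge0. Qed.

Lemma mean_sqnormE k : mean_sqnorm P (u k) = (\int[P]_w (energy k w)%:E)%E.
Proof.
by rewrite /mean_sqnorm unlock; apply: eq_integral => w _; rewrite L2norm_sq.
Qed.

Definition phiL2 (i : 'I_m) : L2 R := projT1 (cid (Vh_L2 N_gt0 (phi_Vh R N_gt0 i))).

Lemma phiL2E i : phiL2 i = phi i :> (R -> R).
Proof. exact: (projT2 (cid (Vh_L2 N_gt0 (phi_Vh R N_gt0 i)))). Qed.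

Definition nodal_noise k (i : 'I_m) := wiener_step W tau k (phiL2 i).

Lemma noise_test k w :
  ip (W (k.+1%:R * tau) w - W (k%:R * tau) w : L2 R) (u k w) =
  \sum_(i < m) coord k i w * nodal_noise k i w.
Proof.
rewrite ipE dotC dot_u; last exact: L2_sqint.
apply: eq_bigr => i _; congr (_ * _).
by rewrite /nodal_noise /wiener_step -ip_subl phiL2E dotC.
Qed.

Lemma growth K c : 0 < K ->
  (forall v v', Vh N v -> Vh N v' ->
    `|form N tau v v'| <= K * L2norm v * L2norm v') ->
  (forall x, K ^+ 2 * (2 * x - c) <= 2 * tau * x ^+ 2 - 3 * x) ->
  forall k, {ae P, forall w, 2 * energy k w - c -
    2 * Num.sqrt 2 / K ^+ 2 * (\sum_(i < m) coord k i w * nodal_noise k i w)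
    <= energy k.+1 w}.
Proof.
move=> K0 HK Hc k; apply: filterS (u_scheme k) => w /(_ _ (u_Vh k w)).
rewrite noise_test => /(scheme_energy N_gt0 tau_gt0 K0 HK (u_Vh k w) (u_Vh k.+1 w)).
have := Hc (energy k w); rewrite -/(energy k w) -/(energy k.+1 w).
set S := \sum_(i < m) _; set x := energy k w; set y := energy k.+1 w => h1 h2.
have K20 : 0 < K ^+ 2 by rewrite exprn_gt0.
rewrite -(ler_pM2l K20) mulrBr (_ : K ^+ 2 * (_ * S) = 2 * Num.sqrt 2 * S).
  by lra.
by field; rewrite gt_eqF.
Qed.

Lemma coord_sqint k i : (mean_sqnorm P (u k) < +oo)%E -> sqint P (coord k i).
Proof.
rewrite mean_sqnormE => mk; have [C C0 nodeC] := node_le_norm R N_gt0.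
apply/sqintP; split; first exact: coord_measurable.
apply: (@le_lt_trans _ _ (\int[P]_w (C%:E * (energy k w)%:E))%E).
  apply: le_integral_ge0 => w; first by rewrite lee_fin sqr_ge0.
  by rewrite -EFinM lee_fin; exact: nodeC (u_Vh k w) i.
rewrite ge0_integralZl//.
- by rewrite lte_mul_pinfty.
- exact/measurable_EFinP/energy_measurable.
- by move=> w _; rewrite lee_fin energy_ge0.
Qed.

Lemma nodal_noise_sqint k i : sqint P (nodal_noise k i).
Proof. exact: wiener_step_sqint. Qed.

(** The nodal value is replaced by its known modification, to which the noise of
    step [k] is orthogonal. *)
Lemma cross_centred k i : (mean_sqnorm P (u k) < +oo)%E ->
  (\int[P]_w (coord k i w * nodal_noise k i w)%:E = 0)%E.
Proof.
move=> mk; have sc := coord_sqint i mk; have sn := nodal_noise_sqint k i.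
have [X kX cX] := nodal_known (leqnn k) i.
have mX : measurable_fun setT X by exact: (known_measurable kX).
have sX : sqint P X.
  apply/sqintP; split=> //; apply: le_lt_trans ((sqintP _ _).1 sc).2.
  rewrite le_eqVlt; apply/orP; left; apply/eqP; apply: ae_eq_integral => //.
  - exact/measurable_EFinP/measurable_funX.
  - exact/measurable_EFinP/measurable_funX/coord_measurable.
  - by apply: filterS cX => w wX _; rewrite /coord wX.
transitivity (\int[P]_w (X w * nodal_noise k i w)%:E)%E.
  apply: ae_eq_integral => //.
  - apply/measurable_EFinP/measurable_funM; first exact: coord_measurable.
    exact: (sqint_measurable sn).
  - by apply/measurable_EFinP/measurable_funM => //; exact: (sqint_measurable sn).
  - by apply: filterS cX => w wX _; rewrite /coord wX.
apply: centred_mul => // B mB.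
apply: known_noise_centred.
by have := kX measurableT B mB; rewrite setTI.
Qed.


Notation mean k := (mean_sqnorm P (u k)).

Lemma energy_integrable k : (mean k < +oo)%E ->
  P.-integrable setT (EFin \o energy k).
Proof.
rewrite mean_sqnormE => mk; apply/integrableP; split.
  by apply/measurable_EFinP; exact: energy_measurable.
apply: le_lt_trans mk; apply: le_integral_ge0 => // w.
by rewrite /= ger0_norm ?energy_ge0.
Qed.

Lemma Rintegral_ae_ge0 (g : Omega -> R) : P.-integrable setT (EFin \o g) ->
  {ae P, forall w, 0 <= g w} -> 0 <= (\int[P]_w g w)%R.
Proof.
move=> ig g0; have mg := measurable_int _ ig.
rewrite /Rintegral fine_ge0// (@ae_eq_integral _ _ _ _ _ (fun w => `|g w|%:E))//.
- by apply: integral_ge0 => w _; rewrite lee_fin.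
- by apply/measurable_EFinP/measurableT_comp => //; exact/measurable_EFinP.
- by apply: filterS g0 => w gw _; rewrite ger0_norm.
Qed.

Variables K c : R.
Hypothesis K_gt0 : 0 < K.
Hypothesis K_bound : forall v v', Vh N v -> Vh N v' ->
  `|form N tau v v'| <= K * L2norm v * L2norm v'.
Hypothesis c_bound : forall x, K ^+ 2 * (2 * x - c) <= 2 * tau * x ^+ 2 - 3 * x.

Let a := 2 * Num.sqrt 2 / K ^+ 2.
Let step k := growth K_gt0 K_bound c_bound k.

Lemma mean_step k : (mean k < +oo)%E ->
  (2%:E * mean k - c%:E <= mean k.+1)%E.
Proof.
move=> mk; have [m1|] := ltP (mean k.+1) +oo%E; last first.
  by rewrite leye_eq => /eqP ->; rewrite leey.
have ik := energy_integrable mk; have i1 := energy_integrable m1.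
have scoord i := coord_sqint i mk.
have snoise i := nodal_noise_sqint k i.
pose S w := \sum_(i < m) coord k i w * nodal_noise k i w.
have iS : P.-integrable setT (EFin \o S).
  rewrite (_ : EFin \o S = fun w => \sum_(i < m) (coord k i w * nodal_noise k i w)%:E)%E.
    by apply: integrable_sum => // i _; exact: sqint_mul_integrable.
  by apply/funext => w; rewrite /S/= -sumEFin.
have S0 : (\int[P]_w S w = 0)%R.
  rewrite /Rintegral; under eq_integral do rewrite -sumEFin.
  rewrite integral_sum//; last by move=> i; exact: sqint_mul_integrable.
  rewrite big1// => i _; exact: cross_centred.
have icst r : P.-integrable setT (EFin \o cst r) by exact: finite_measure_integrable_cst.
have fin k' : (mean k' < +oo)%E -> mean k' = ((\int[P]_w energy k' w)%R)%:E.
  move=> h; rewrite mean_sqnormE /Rintegral fineK//.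
  exact: (integrable_fin_num measurableT (energy_integrable h)).
pose G w := energy k.+1 w - (2 * energy k w - c - a * S w).
have i2x : P.-integrable setT (EFin \o (fun w => 2 * energy k w)).
  exact: (integrableZl measurableT 2 ik).
have iaS : P.-integrable setT (EFin \o (fun w => a * S w)).
  exact: (integrableZl measurableT a iS).
have i2xc : P.-integrable setT (EFin \o (fun w => 2 * energy k w - c)).
  exact: (integrableB measurableT i2x (icst c)).
have irhs : P.-integrable setT (EFin \o (fun w => 2 * energy k w - c - a * S w)).
  exact: (integrableB measurableT i2xc iaS).
have iG : P.-integrable setT (EFin \o G).
  exact: (integrableB measurableT i1 irhs).
have : 0 <= (\int[P]_w G w)%R.
  apply: Rintegral_ae_ge0 => //.
  by apply: filterS (step k) => w; rewrite /G subr_ge0.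
rewrite /G RintegralB// RintegralB// RintegralB//; last exact: icst.
rewrite (@RintegralZl _ _ _ P setT (energy k) 2)//.
rewrite (@RintegralZl _ _ _ P setT S a)// S0 mulr0 subr0.
rewrite Rintegral_cst// [X in c * X](congr1 fine (probability_setT P)).
rewrite mulr1 subr_ge0.
by rewrite (fin _ mk) (fin _ m1) -EFinM -EFinB lee_fin.
Qed.

(** By Young's inequality each cross term [a U b] is at most
    [eps U^2 + kappa b^2], and [eps] is chosen such that the sum of the terms
    [eps U^2] is at most the energy.  Of the two copies of the energy of step
    [k] in [growth] one is left, and it is bounded by integrable terms. *)
Lemma mean_finite_back k : (mean k.+1 < +oo)%E -> (mean k < +oo)%E.
Proof.
move=> m1; have [C C0 nodeC] := node_le_norm R N_gt0.
have snoise i := nodal_noise_sqint k i.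
pose eps : R := (m%:R * C + 1)^-1.
have mC0 : 0 <= m%:R * C by rewrite mulr_ge0.
have eps0 : 0 < eps by rewrite invr_gt0 ltr_wpDl.
pose kappa := a ^+ 2 / (4 * eps).
have kappa0 : 0 <= kappa by rewrite divr_ge0 ?sqr_ge0// mulr_ge0// ltW.
pose B w := \sum_(i < m) nodal_noise k i w ^+ 2.
have mB : measurable_fun setT B.
  apply: measurable_sum => i; apply: measurable_funX.
  exact: (sqint_measurable (snoise i)).
have B0 w : 0 <= B w by apply: sumr_ge0 => i _; exact: sqr_ge0.
have iB : P.-integrable setT (EFin \o B).
  rewrite (_ : EFin \o B = fun w => \sum_(i < m) (nodal_noise k i w ^+ 2)%:E)%E.
    by apply: integrable_sum => // i _; exact: (Lfun2_integrable_sqr (snoise i)).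
  by apply/funext => w; rewrite /B/= -sumEFin.
have c0 : 0 <= c.
  have := c_bound 0; rewrite mulr0 expr0n/= !mulr0 subr0 sub0r.
  by rewrite pmulr_rle0 ?exprn_gt0// oppr_le0.
have ae_le : {ae P, forall w, energy k w <= energy k.+1 w + c + kappa * B w}.
  apply: filterS (step k) => w.
  set S := \sum_(i < m) _ => h.
  suff : a * S <= energy k w + kappa * B w by rewrite -/a in h; lra.
  have key i : a * (coord k i w * nodal_noise k i w) <=
      eps * coord k i w ^+ 2 + kappa * nodal_noise k i w ^+ 2.
    set U := coord k i w; set b := nodal_noise k i w.
    rewrite -subr_ge0 (_ : _ - _ = eps * (U - a * b / (2 * eps)) ^+ 2).
      by rewrite mulr_ge0 ?sqr_ge0// ltW.
    by rewrite /kappa; field; rewrite gt_eqF.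
  rewrite /S mulr_sumr; apply: le_trans (ler_sum _ (fun i _ => key i)) _.
  rewrite big_split/=; apply: lerD; last by rewrite /B mulr_sumr.
  rewrite -mulr_sumr.
  apply: (@le_trans _ _ (eps * (m%:R * C * energy k w))).
    rewrite ler_wpM2l ?(ltW eps0)//.
    apply: le_trans (ler_sum _ (fun i _ => nodeC _ (u_Vh k w) i)) _.
    by rewrite sumr_const card_ord -mulrA mulr_natl.
  rewrite mulrA ler_piMl ?energy_ge0// /eps mulrC ler_pdivrMr ?ltr_wpDl//.
  by rewrite mul1r lerDl.
pose D w := energy k.+1 w + c + kappa * B w.
have iD : P.-integrable setT (EFin \o D).
  have h1 := integrableD measurableT (energy_integrable m1)
    (finite_measure_integrable_cst P c measurableT).
  exact: (integrableD measurableT h1 (integrableZl measurableT kappa iB)).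
have D0 w : 0 <= D w.
  by apply: addr_ge0; [apply: addr_ge0; [exact: energy_ge0|]|exact: mulr_ge0].
rewrite mean_sqnormE; apply: (@le_lt_trans _ _ (\int[P]_w (D w)%:E)%E).
  apply: ae_ge0_le_integral => //.
  - by move=> w _; rewrite lee_fin energy_ge0.
  - by apply/measurable_EFinP; exact: energy_measurable.
  - by move=> w _; rewrite lee_fin.
  - exact: measurable_int iD.
  - by apply: filterS ae_le => w h _; rewrite lee_fin.
have /integrableP[_] := iD; apply: le_lt_trans.
by apply: le_integral_ge0 => w; rewrite ?lee_fin //= ger0_norm.
Qed.

Lemma mean_increase k : ((c + tau)%:E < mean k)%E ->
  (mean k + tau%:E <= mean k.+1)%E.
Proof.
move=> ck; have [m1|] := ltP (mean k.+1) +oo%E; last first.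
  by rewrite leye_eq => /eqP ->; rewrite leey.
have mk := mean_finite_back m1; have := mean_step mk.
have m0 k' : (0 <= mean k')%E.
  by rewrite mean_sqnormE; apply: integral_ge0 => w _; rewrite lee_fin energy_ge0.
move: ck mk m1 (m0 k) (m0 k.+1).
case: (mean k) => [x| |]//; case: (mean k.+1) => [y| |]//.
by rewrite !lte_fin -EFinM -EFinB -EFinD !lee_fin => *; lra.
Qed.

Lemma mean_growth : ((c + tau)%:E < mean 0%N)%E -> forall k,
  (mean 0%N + (k%:R * tau)%:E <= mean k)%E.
Proof.
move=> c0; elim=> [|k IH]; first by rewrite mul0r adde0.
have ck : ((c + tau)%:E < mean k)%E.
  apply: lt_le_trans c0 (le_trans _ IH).
  by rewrite leeDl// lee_fin mulr_ge0// ltW.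
apply: le_trans (mean_increase ck).
rewrite -natr1 mulrDl mul1r EFinD addeA.
exact: leeD2r.
Qed.

End scheme.

Lemma cvg_pinfty_of_linear (R : realType) (tau : R) (f : nat -> \bar R) :
  0 < tau -> (forall k, ((k%:R * tau)%:E <= f k)%E) -> f @ \oo --> +oo%E.
Proof.
move=> tau0 fk; apply/cvgeyPge => A.
exists (Num.truncn (A / tau)).+1 => // k /= Ak.
apply: le_trans (fk k); rewrite lee_fin -ler_pdivrMr//.
by apply: le_trans (ltW (truncnS_gt _)) _; rewrite ler_nat.
Qed.

Theorem lemma5p1 (R : realType) (N : nat) (N_gt0 : (0 < N)%N)
    (tau : R) (tau_gt0 : 0 < tau) :
  exists a0 : R, 0 < a0 /\
  forall (d : measure_display) (Omega : measurableType d)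
    (P : probability Omega R)
    (Q : L2 R -> L2 R) (e : nat -> L2 R) (gamma : nat -> R)
    (beta : nat -> R -> Omega -> R) (W : R -> Omega -> L2 R)
    (u : nat -> Omega -> R -> R),
  covariance_operator Q e gamma ->
  Q_wiener P e gamma beta W ->
  (forall n w, Vh N (u n w)) ->
  (forall n, L2_measurable (u n)) ->
  independent P (L2_sigma [set 0%N] u) (L2_sigma [set t : R | 0 <= t] W) ->
  fem_euler_scheme P N tau W u ->
  (a0%:E < mean_sqnorm P (u 0%N))%E ->
  [/\ forall n : nat,
        (mean_sqnorm P (u 0%N) + (n%:R * tau)%:E <= mean_sqnorm P (u n))%E,
      (mean_sqnorm P (u 0%N) + (n%:R * tau)%:E)%E @[n --> \oo] --> +oo%E &
      mean_sqnorm P (u n) @[n --> \oo] --> +oo%E].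
Proof.
have [K K0 HK] := form_bounded N_gt0 tau.
have [c c0 Hc] := growth_poly tau_gt0 K0.
exists (c + tau); split; first by rewrite ltr_wpDl.
move=> d Omega P Q e gamma beta W u _ HW u_Vh u_meas u0_indep u_scheme a0.
have H := mean_growth N_gt0 tau_gt0 HW u_Vh u_meas u0_indep u_scheme K0 HK Hc a0.
have lin k : ((k%:R * tau)%:E <= mean_sqnorm P (u 0%N) + (k%:R * tau)%:E)%E.
  rewrite leeDr// mean_sqnormE; apply: integral_ge0 => w _.
  by rewrite lee_fin energy_ge0.
split=> //; apply: (cvg_pinfty_of_linear tau_gt0) => // k.
exact: le_trans (H k).
Qed.
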